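(* Let $(S(\mathcal E_\bullet),\delta)$ and $(S(\mathcal E'_\bullet),\delta')$ be two Koszul-Tate resolutions of $\mathcal O/\mathcal I$. Then their reduced complexes $(\mathcal E_\bullet\otimes\mathcal O/\mathcal I,\underline\delta)$ and $(\mathcal E'_\bullet\otimes\mathcal O/\mathcal I,\underline\delta')$ are homotopy equivalent, and there is a distinguished homotopy class of homotopy equivalences between them, namely the one induced by morphisms of differential graded commutative $\mathcal O$-algebras between the two Koszul-Tate resolutions. In particular, the homology of the reduced complex is canonically attached to the ideal $\mathcal I\subset\mathcal O$, i.e. does not depend, up to canonical isomorphism, on the choice of the Koszul-Tate resolution.
   Context: $\mathbb K$ is the base field, of characteristic $0$, $\mathcal O$ a commutative $\mathbb K$-algebra, $\mathcal I\subset\mathcal O$ a proper ideal. $S(\mathcal E)$ is the graded symmetric $\mathcal O$-algebra of a graded $\mathcal O$-module, $S^{\ge2}(\mathcal E)=\bigoplus_{k\ge2}S^k(\mathcal E)$. Koszul-Tate resolution of $\mathcal O/\mathcal I$: a pair $(S(\mathcal E_\bullet),\delta)$ with $\mathcal E_\bullet=(\mathcal E_i)_{i\ge1}$ free/projective $\mathcal O$-modules ($\mathcal E_i$ in degree $i$) and $\delta$ a degree $-1$ ($\mathcal O$-linear) derivation with $\delta^2=0$, whose homology is zero except in degree $0$, where it is $\mathcal O/\mathcal I$. Reduced complex of $\mathcal O/\mathcal I$ attached to $(S(\mathcal E_\bullet),\delta)$: the complex $(\mathcal E_\bullet\otimes_{\mathcal O}\mathcal O/\mathcal I,\underline\delta)$,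 in degrees $\ge1$, where $\underline\delta:\mathcal E_{i+1}\otimes\mathcal O/\mathcal I\to\mathcal E_i\otimes\mathcal O/\mathcal I$ ($i\ge1$) is induced by $\delta:\mathcal E_{i+1}\to S(\mathcal E)_i$ followed by the projection modulo $S^{\ge2}(\mathcal E)$ and modulo $\mathcal I\mathcal E_i$ (this is well defined because $\delta$ preserves $\mathcal I\mathcal E_\bullet\oplus S^{\ge2}(\mathcal E)$ in positive degrees). Such a dg algebra morphism $S(\mathcal E)\to S(\mathcal E')$ induces a chain map of reduced complexes in the same way. *)

(* Defs.v *)
From HB Require Import structures.
From mathcomp Require Import all_boot all_algebra.
From mathcomp Require Import boolp.

Set Implicit Arguments.
Unset Strict Implicit.
Unset Printing Implicit Defensive.

Import GRing.Theory.
Local Open Scope ring_scope.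
Local Open Scope quotient_scope.

Section Span.
Variables (R : pzRingType) (M : lmodType R) (P : M -> Prop).

Inductive in_span : M -> Prop :=
| in_span0 : in_span 0
| in_spanS a x y : P x -> in_span y -> in_span (a *: x + y).

Definition lspan : {pred M} := fun x => `[< in_span x >].

Lemma lspanP x : reflect (in_span x) (x \in lspan).
Proof. exact: asboolP. Qed.

Lemma lspan_submod_closed : submod_closed lspan.
Proof.
split=> [|a x y /lspanP hx /lspanP hy]; first by apply/lspanP; constructor.
apply/lspanP; elim: hx => [|b u v Pu _ ih]; first by rewrite scaler0 add0r.
by rewrite scalerDr scalerA -addrA; constructor.
Qed.

HB.instance Definition _ :=
  GRing.isSubmodClosed.Build R M lspan lspan_submod_closed.

Lemma mem_lspan x : P x -> x \in lspan.
Proof.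
move=> Px; apply/lspanP; rewrite -[x]addr0 -[x]scale1r.
exact: in_spanS Px in_span0.
Qed.

End Span.

Section QuotientModule.
Variables (R : pzRingType) (M : lmodType R) (N : submodClosed M).

(* [submodClosed] does not record closure under opposite, which
   [Quotient.quot] expects. *)
Definition submod_pred : {pred M} := N.
Lemma submod_pred_closed : zmod_closed submod_pred.
Proof.
split=> [|x y hx hy]; first exact: (rpred0 N).
by rewrite -scaleN1r; apply: (rpredD (S := N)) => //; apply: (rpredZ (s := N)).
Qed.
HB.instance Definition _ :=
  GRing.isZmodClosed.Build M submod_pred submod_pred_closed.

Definition quot_mod : Type := Quotient.quot submod_pred.
HB.instance Definition _ := GRing.Zmodule.on quot_mod.
HB.instance Definition _ := EqQuotient.on quot_mod.

Definition qclass (x : M) : quot_mod := \pi_(Quotient.quot submod_pred) x.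

Lemma qclassE x y : (qclass x = qclass y) <-> (x - y \in N).
Proof.
by rewrite /qclass; split=> [/eqP|h]; [|apply/eqP]; rewrite -Quotient.idealrBE.
Qed.

Lemma qclass_repr q : qclass (repr (q : Quotient.quot submod_pred)) = q.
Proof. exact: reprK. Qed.

Lemma qclassD x y : qclass (x + y) = qclass x + qclass y.
Proof. by rewrite /qclass !piE. Qed.

Definition qscale (a : R) (q : quot_mod) : quot_mod :=
  qclass (a *: repr (q : Quotient.quot submod_pred)).

Lemma qscaleE a x : qscale a (qclass x) = qclass (a *: x).
Proof.
by apply/qclassE; rewrite -scalerBr; apply: (rpredZ (s := N)); apply/qclassE; exact: reprK.
Qed.

Lemma qscaleA a b q : qscale a (qscale b q) = qscale (a * b) q.
Proof. by rewrite -[q]qclass_repr !qscaleE scalerA. Qed.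
Lemma qscale1 : left_id 1 qscale.
Proof. by move=> q; rewrite -[q]qclass_repr qscaleE scale1r. Qed.
Lemma qscaleDr : right_distributive qscale +%R.
Proof.
move=> a q r; rewrite -[q]qclass_repr -[r]qclass_repr.
by rewrite -qclassD !qscaleE -qclassD scalerDr.
Qed.
Lemma qscaleDl q : {morph qscale^~ q : a b / a + b}.
Proof. by move=> a b; rewrite -[q]qclass_repr !qscaleE -qclassD scalerDl. Qed.

HB.instance Definition _ :=
  GRing.Zmodule_isLmodule.Build R quot_mod qscaleA qscale1 qscaleDr qscaleDl.

Lemma qclass_is_linear : linear qclass.
Proof. by move=> a x y; rewrite qclassD -qscaleE. Qed.
HB.instance Definition _ :=
  GRing.isLinear.Build R M quot_mod _ qclass qclass_is_linear.

Lemma qclass0 x : (qclass x = 0) <-> (x \in N).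
Proof. by rewrite -[0](linear0 qclass) qclassE subr0. Qed.

Section Lift.
Variables (M' : lmodType R) (g : {linear M -> M'}).
Hypothesis gN : forall x, x \in N -> g x = 0.

Definition quot_lift (_ : forall x, x \in N -> g x = 0) (q : quot_mod) : M' :=
  g (repr (q : Quotient.quot submod_pred)).

Lemma quot_liftE x : quot_lift gN (qclass x) = g x.
Proof.
apply/eqP; rewrite -subr_eq0 /quot_lift -linearB; apply/eqP/gN/qclassE.
exact: reprK.
Qed.

Lemma quot_lift_is_linear : linear (quot_lift gN).
Proof.
move=> a q r; rewrite -[q]qclass_repr -[r]qclass_repr -linearP.
by rewrite !quot_liftE linearP.
Qed.
HB.instance Definition _ :=
  GRing.isLinear.Build R quot_mod M' _ (quot_lift gN) quot_lift_is_linear.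
End Lift.

End QuotientModule.

Definition projective (R : pzRingType) (P : lmodType R) : Prop :=
  forall (M N : lmodType R) (g : {linear M -> N}) (f : {linear P -> N}),
    (forall y, exists x, g x = y) ->
    exists h : {linear P -> M}, forall x, g (h x) = f x.

(* Complexes concentrated in degrees >= 1: [C n] is the term of degree n+1. *)
Record chain_complex (R : pzRingType) := ChainComplex {
  cc_mod :> nat -> lmodType R;
  cc_d : forall n, {linear cc_mod n.+1 -> cc_mod n};
  cc_dd : forall n x, cc_d n (cc_d n.+1 x) = 0 }.
Arguments cc_d {R} c n.

Record chain_map (R : pzRingType) (C D : chain_complex R) := ChainMap {
  cm_fun :> forall n, {linear C n -> D n};
  cm_comm : forall n x, cm_fun n (cc_d C n x) = cc_d D n (cm_fun n.+1 x) }.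

Section Chains.
Variable R : pzRingType.
Implicit Types C D F : chain_complex R.

Definition chain_id C : chain_map C C :=
  @ChainMap R C C (fun n => idfun : {linear C n -> C n}) (fun n x => erefl).

Lemma chain_comp_comm C D F (g : chain_map D F) (f : chain_map C D) n x :
  (g n \o f n) (cc_d C n x) = cc_d F n ((g n.+1 \o f n.+1) x).
Proof. by rewrite /= !cm_comm. Qed.

Definition chain_comp C D F (g : chain_map D F) (f : chain_map C D) :
    chain_map C F :=
  @ChainMap R C F (fun n => (g n \o f n : {linear C n -> F n}))
    (chain_comp_comm g f).

Definition homotopic C D (f g : chain_map C D) : Prop :=
  exists h : forall n, {linear C n -> D n.+1},
    (forall x, f 0%N x - g 0%N x = cc_d D 0 (h 0%N x)) /\
    (forall n x, f n.+1 x - g n.+1 x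
       = cc_d D n.+1 (h n.+1 x) + h n (cc_d C n x)).

Definition homotopy_equivalence C D (f : chain_map C D) : Prop :=
  exists g : chain_map D C,
    homotopic (chain_comp g f) (chain_id C) /\
    homotopic (chain_comp f g) (chain_id D).

Definition homotopy_equivalent C D : Prop :=
  exists f : chain_map C D, homotopy_equivalence f.

Definition homotopy_class C D (H : chain_map C D -> Prop) : Prop :=
  exists f, forall g, H g <-> homotopic f g.

Section Homology.
Variables (C : chain_complex R) (n : nat).

Definition is_cycle : {pred C n} :=
  match n return {pred C n} with
  | 0 => fun _ => true
  | m.+1 => fun x => cc_d C m x == 0
  end.

Lemma is_cycle_submod_closed : submod_closed is_cycle.
Proof.
rewrite /is_cycle; case: n => [|m]; first by split.
split=> [|a x y]; rewrite !unfold_in ?linear0 // => /eqP hx /eqP hy.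
by rewrite linearP hx hy scaler0 addr0.
Qed.
HB.instance Definition _ :=
  GRing.isSubmodClosed.Build R (C n) is_cycle is_cycle_submod_closed.

Record cycle : Type := Cycle {
  cycle_val : C n;
  cycle_valP : cycle_val \in is_cycle }.

HB.instance Definition _ := [isSub for cycle_val].
HB.instance Definition _ := [Choice of cycle by <:].
HB.instance Definition _ := [SubChoice_isSubLmodule of cycle by <:].

Definition is_boundary : {pred cycle} :=
  fun z => `[< exists y, cycle_val z = cc_d C n y >].

Lemma is_boundary_submod_closed : submod_closed is_boundary.
Proof.
split=> [|a x y /asboolP[u hu] /asboolP[v hv]]; apply/asboolP.
  by exists 0; rewrite linear0.
by exists (a *: u + v); rewrite linearP -hu -hv.
Qed.
HB.instance Definition _ :=
  GRing.isSubmodClosed.Build R cycle is_boundary is_boundary_submod_closed.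

Definition homology : lmodType R := quot_mod is_boundary.
End Homology.
Arguments is_cycle C n : clear implicits.
Arguments is_boundary C n : clear implicits.

Section HomologyMap.
Variables (C D : chain_complex R) (f : chain_map C D) (n : nat).

Lemma cycle_map_subproof (z : cycle C n) : f n (cycle_val z) \in is_cycle D n.
Proof.
case: n z => [|m] [z hz] //=; move: hz; rewrite !unfold_in => /eqP hz.
by rewrite -cm_comm hz linear0.
Qed.

Definition cycle_map (z : cycle C n) : cycle D n :=
  Cycle (cycle_map_subproof z).

Lemma cycle_map_is_linear : linear cycle_map.
Proof. by move=> a x y; apply/val_inj; rewrite /= linearP. Qed.
HB.instance Definition _ := GRing.isLinear.Build R (cycle C n) (cycle D n) _
  cycle_map cycle_map_is_linear.

Definition hclass_map : {linear cycle C n -> homology D n} :=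
  @qclass R (cycle D n) (is_boundary D n) \o cycle_map.

Lemma hclass_map_boundary z : z \in is_boundary C n -> hclass_map z = 0.
Proof.
move=> /asboolP[y hy]; apply/qclass0/asboolP; exists (f n.+1 y).
by rewrite /= hy cm_comm.
Qed.

Definition homology_map : {linear homology C n -> homology D n} :=
  quot_lift hclass_map_boundary.
End HomologyMap.

End Chains.

(* [E : nat -> lmodType O] encodes a graded module concentrated in degrees
   >= 1: [E i] sits in degree i+1.  [symalg E] is the O-algebra generated by
   the E i, subject to O-linearity of E i -> symalg E and to the relations
   x y = (-1)^(|x||y|) y x; it is the quotient of the terms [sterm E] by the
   congruence [scong]. *)
Section SymAlg.
Variables (O : comNzRingType) (E : nat -> lmodType O).

Inductive sterm : Type :=
| Cst (a : O)
| Gen (i : nat) (x : E i)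
| Add (s t : sterm)
| Mul (s t : sterm).

Inductive scong : sterm -> sterm -> Prop :=
| sc_refl s : scong s s
| sc_sym s t : scong s t -> scong t s
| sc_trans s t u : scong s t -> scong t u -> scong s u
| sc_add s s' t t' : scong s s' -> scong t t' -> scong (Add s t) (Add s' t')
| sc_mul s s' t t' : scong s s' -> scong t t' -> scong (Mul s t) (Mul s' t')
| sc_addA s t u : scong (Add s (Add t u)) (Add (Add s t) u)
| sc_addC s t : scong (Add s t) (Add t s)
| sc_add0 s : scong (Add (Cst 0) s) s
| sc_mulA s t u : scong (Mul s (Mul t u)) (Mul (Mul s t) u)
| sc_mul1l s : scong (Mul (Cst 1) s) s
| sc_mul0l s : scong (Mul (Cst 0) s) (Cst 0)
| sc_mulDl s t u : scong (Mul (Add s t) u) (Add (Mul s u) (Mul t u))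
| sc_mulDr s t u : scong (Mul u (Add s t)) (Add (Mul u s) (Mul u t))
| sc_cstD a b : scong (Cst (a + b)) (Add (Cst a) (Cst b))
| sc_cstM a b : scong (Cst (a * b)) (Mul (Cst a) (Cst b))
| sc_cstC a s : scong (Mul (Cst a) s) (Mul s (Cst a))
| sc_genP a i (x y : E i) :
    scong (Gen (a *: x + y)) (Add (Mul (Cst a) (Gen x)) (Gen y))
| sc_genC i j (x : E i) (y : E j) :
    scong (Mul (Gen x) (Gen y))
          (Mul (Cst ((-1) ^+ (i.+1 * j.+1))) (Mul (Gen y) (Gen x))).

HB.instance Definition _ := gen_eqMixin sterm.
HB.instance Definition _ := gen_choiceMixin sterm.

Definition scongb (s t : sterm) : bool := `[< scong s t >].

Lemma scongb_equiv : equiv_class_of scongb.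
Proof.
split=> [s|s t|t s u].
- by apply/asboolP; exact: sc_refl.
- by apply/asboolP/asboolP; exact: sc_sym.
- by move=> /asboolP st /asboolP tu; apply/asboolP; exact: sc_trans st tu.
Qed.
Canonical scongb_equivRel := EquivRelPack scongb_equiv.
Canonical scongb_encModRel := defaultEncModRel scongb.

Definition symalg : Type := {eq_quot scongb}.
HB.instance Definition _ := Choice.on symalg.

Definition scl (s : sterm) : symalg := \pi_({eq_quot scongb}) s.
Definition srp (u : symalg) : sterm := repr (u : {eq_quot scongb}).

Lemma srpK u : scl (srp u) = u. Proof. exact: reprK. Qed.
Lemma scl_eq s t : (scl s = scl t) <-> scong s t.
Proof.
split=> [/eqP|h]; last apply/eqP; rewrite /scl.
  by rewrite eqmodE => /asboolP.
by rewrite eqmodE; apply/asboolP.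
Qed.
Lemma srp_scl s : scong (srp (scl s)) s.
Proof. exact/scl_eq/srpK. Qed.

Definition s_add u v := scl (Add (srp u) (srp v)).
Definition s_mul u v := scl (Mul (srp u) (srp v)).
Definition s_opp u := scl (Mul (Cst (-1)) (srp u)).
Definition s_scale a u := scl (Mul (Cst a) (srp u)).

Lemma s_addE s t : s_add (scl s) (scl t) = scl (Add s t).
Proof. by apply/scl_eq/sc_add; exact: srp_scl. Qed.
Lemma s_mulE s t : s_mul (scl s) (scl t) = scl (Mul s t).
Proof. by apply/scl_eq/sc_mul; exact: srp_scl. Qed.
Lemma s_oppE s : s_opp (scl s) = scl (Mul (Cst (-1)) s).
Proof. by apply/scl_eq/sc_mul; [exact: sc_refl|exact: srp_scl]. Qed.
Lemma s_scaleE a s : s_scale a (scl s) = scl (Mul (Cst a) s).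
Proof. by apply/scl_eq/sc_mul; [exact: sc_refl|exact: srp_scl]. Qed.

Lemma s_addA : associative s_add.
Proof.
move=> u v w; rewrite -[u]srpK -[v]srpK -[w]srpK !s_addE.
exact/scl_eq/sc_addA.
Qed.
Lemma s_addC : commutative s_add.
Proof. by move=> u v; apply/scl_eq/sc_addC. Qed.
Lemma s_add0 : left_id (scl (Cst 0)) s_add.
Proof. by move=> u; rewrite -[u]srpK s_addE; apply/scl_eq/sc_add0. Qed.
Lemma s_addN : left_inverse (scl (Cst 0)) s_opp s_add.
Proof.
move=> u; rewrite -[u]srpK s_oppE s_addE; apply/scl_eq; set s := srp u.
apply: sc_trans (sc_mul0l s); rewrite -(addNr 1).
apply: (sc_trans (t := Add (Mul (Cst (-1)) s) (Mul (Cst 1) s))).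
  by apply: sc_add; [exact: sc_refl | exact/sc_sym/sc_mul1l].
apply: sc_trans (sc_sym (sc_mulDl _ _ _)) _.
by apply: sc_mul (sc_refl _); exact/sc_sym/sc_cstD.
Qed.
HB.instance Definition _ :=
  GRing.isZmodule.Build symalg s_addA s_addC s_add0 s_addN.

Fixpoint aug_t (s : sterm) : O :=
  match s with
  | Cst a => a
  | Gen _ _ => 0
  | Add s t => aug_t s + aug_t t
  | Mul s t => aug_t s * aug_t t
  end.

Lemma aug_t_cong s t : scong s t -> aug_t s = aug_t t.
Proof.
elim=> //= *; rewrite ?(mul1r, mul0r, mulr0, add0r, addr0) //; try congruence.
- exact: addrA.
- exact: addrC.
- exact: mulrA.
- exact: mulrDl.
- exact: mulrDr.
- exact: mulrC.
Qed.

Lemma s_mulA : associative s_mul.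
Proof.
move=> u v w; rewrite -[u]srpK -[v]srpK -[w]srpK !s_mulE.
exact/scl_eq/sc_mulA.
Qed.
Lemma s_mul1l : left_id (scl (Cst 1)) s_mul.
Proof. by move=> u; rewrite -[u]srpK s_mulE; apply/scl_eq/sc_mul1l. Qed.
Lemma s_mul1r : right_id (scl (Cst 1)) s_mul.
Proof.
move=> u; rewrite -[u]srpK s_mulE; apply/scl_eq.
exact: sc_trans (sc_sym (sc_cstC _ _)) (sc_mul1l _).
Qed.
Lemma s_mulDl : left_distributive s_mul +%R.
Proof.
move=> u v w; rewrite -[u]srpK -[v]srpK -[w]srpK.
rewrite /GRing.add /= !(s_addE, s_mulE); exact/scl_eq/sc_mulDl.
Qed.
Lemma s_mulDr : right_distributive s_mul +%R.
Proof.
move=> w u v; rewrite -[u]srpK -[v]srpK -[w]srpK.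
rewrite /GRing.add /= !(s_addE, s_mulE); exact/scl_eq/sc_mulDr.
Qed.
Lemma s_1neq0 : scl (Cst 1) != 0.
Proof.
apply/eqP => /scl_eq/aug_t_cong /= /eqP; apply/negP; exact: oner_neq0.
Qed.
HB.instance Definition _ := GRing.Zmodule_isNzRing.Build symalg
  s_mulA s_mul1l s_mul1r s_mulDl s_mulDr s_1neq0.

Lemma sclD s t : scl (Add s t) = scl s + scl t.
Proof. by rewrite -s_addE. Qed.
Lemma sclM s t : scl (Mul s t) = scl s * scl t.
Proof. by rewrite -s_mulE. Qed.

Lemma s_scaleM a u : s_scale a u = scl (Cst a) * u.
Proof. by rewrite -[u]srpK s_scaleE sclM. Qed.
Lemma s_cstM a b : scl (Cst (a * b)) = scl (Cst a) * scl (Cst b).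
Proof. by rewrite -sclM; apply/scl_eq/sc_cstM. Qed.
Lemma s_cstD a b : scl (Cst (a + b)) = scl (Cst a) + scl (Cst b).
Proof. by rewrite -sclD; apply/scl_eq/sc_cstD. Qed.

Lemma s_scaleA a b u : s_scale a (s_scale b u) = s_scale (a * b) u.
Proof. by rewrite !s_scaleM mulrA s_cstM. Qed.
Lemma s_scale1 : left_id 1 s_scale.
Proof. by move=> u; rewrite s_scaleM mul1r. Qed.
Lemma s_scaleDr : right_distributive s_scale +%R.
Proof. by move=> a u v; rewrite !s_scaleM mulrDr. Qed.
Lemma s_scaleDl u : {morph s_scale^~ u : a b / a + b}.
Proof. by move=> a b; rewrite !s_scaleM s_cstD mulrDl. Qed.
HB.instance Definition _ := GRing.Zmodule_isLmodule.Build O symalg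
  s_scaleA s_scale1 s_scaleDr s_scaleDl.

Lemma s_scalerAl a (u v : symalg) : a *: (u * v) = a *: u * v.
Proof. by rewrite /GRing.scale /= !s_scaleM mulrA. Qed.
HB.instance Definition _ := GRing.Lmodule_isLalgebra.Build O symalg s_scalerAl.
Lemma s_scalerAr a (u v : symalg) : a *: (u * v) = u * (a *: v).
Proof.
rewrite /GRing.scale /= !s_scaleM !mulrA; congr (_ * _).
by rewrite -[u]srpK -!sclM; apply/scl_eq/sc_cstC.
Qed.
HB.instance Definition _ := GRing.Lalgebra_isAlgebra.Build O symalg s_scalerAr.

Lemma sym_scaleE a (u : symalg) : a *: u = scl (Cst a) * u.
Proof. exact: s_scaleM. Qed.

Lemma scl_cst a : scl (Cst a) = a%:A.
Proof. by rewrite sym_scaleE mulr1. Qed.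

Definition gen (i : nat) (x : E i) : symalg := scl (Gen x).

Lemma gen_is_linear i : linear (@gen i).
Proof.
move=> a x y; rewrite sym_scaleE /gen -sclM -sclD; exact/scl_eq/sc_genP.
Qed.
HB.instance Definition _ i :=
  GRing.isLinear.Build O (E i) symalg _ (@gen i) (@gen_is_linear i).

Lemma gen_comm i j (x : E i) (y : E j) :
  gen x * gen y = (-1) ^+ (i.+1 * j.+1) *: (gen y * gen x).
Proof. by rewrite sym_scaleE /gen -!sclM; apply/scl_eq/sc_genC. Qed.

(* Words in homogeneous elements of E, their total degree and their product. *)
Definition wdeg (w : seq {i & E i}) : nat := (\sum_(x <- w) (tag x).+1)%N.
Definition monom (w : seq {i & E i}) : symalg := \prod_(x <- w) gen (tagged x).

Definition homog (n : nat) : {pred symalg} :=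
  lspan (fun s => exists2 w, wdeg w = n & s = monom w).
HB.instance Definition _ n := GRing.SubmodClosed.on (homog n).

(* S^{>= 2}(E), as the span of the products of at least two elements of E. *)
Definition sym_ge2 : {pred symalg} :=
  lspan (fun s => exists2 w, (1 < size w)%N & s = monom w).
HB.instance Definition _ := GRing.SubmodClosed.on sym_ge2.

(* The augmentation symalg E -> O killing E. *)
Definition aug (u : symalg) : O := aug_t (srp u).

Lemma aug_scl s : aug (scl s) = aug_t s.
Proof. exact/aug_t_cong/srp_scl. Qed.

Lemma aug_is_linear : linear_for *%R aug.
Proof.
move=> a u v; rewrite sym_scaleE -[u]srpK -[v]srpK.
by rewrite -sclM -sclD !aug_scl.
Qed.
HB.instance Definition _ :=
  GRing.isLinear.Build O symalg O _ aug aug_is_linear.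

Lemma augM u v : aug (u * v) = aug u * aug v.
Proof. by rewrite -[u]srpK -[v]srpK -sclM !aug_scl. Qed.

Lemma aug_gen i (x : E i) : aug (gen x) = 0.
Proof. by rewrite aug_scl. Qed.

Lemma aug_cst a : aug a%:A = a.
Proof. by rewrite -scl_cst aug_scl. Qed.

Lemma aug1 : aug 1 = 1.
Proof. by rewrite -[1]scale1r aug_cst. Qed.

Lemma monom_nil : monom [::] = 1.
Proof. exact: big_nil. Qed.
Lemma monom_cons x w : monom (x :: w) = gen (tagged x) * monom w.
Proof. exact: big_cons. Qed.
Lemma monom_seq1 x : monom [:: x] = gen (tagged x).
Proof. exact: big_seq1. Qed.

Lemma aug_monom_cons x w : aug (monom (x :: w)) = 0.
Proof. by rewrite monom_cons augM aug_gen mul0r. Qed.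

Lemma gen_homog i (x : E i) : gen x \in homog i.+1.
Proof.
apply: mem_lspan; exists [:: Tagged E x]; last by rewrite monom_seq1.
by rewrite /wdeg big_seq1.
Qed.

Lemma homog_aug0 n s : s \in homog n.+1 -> aug s = 0.
Proof.
move=> /lspanP; elim=> [|a x y [[|z w] wn ->] _ ih]; first exact: linear0.
  by move: wn; rewrite /wdeg big_nil.
by rewrite linearP /= aug_monom_cons mulr0 add0r.
Qed.

Lemma homog0_cst s : s \in homog 0 -> s = (aug s)%:A.
Proof.
move=> /lspanP; elim=> [|a x y [[|z w] wn ->] _ ih].
- by rewrite linear0 scale0r.
- by rewrite linearP /= monom_nil aug1 mulr1 scalerDl -ih.
- by move: wn; rewrite /wdeg big_cons.
Qed.

(* The projection symalg E -> E i with kernel O + sum_(j != i) E j +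
   S^{>= 2}(E): see [lin_gen], [lin_gen_neq], [lin_cst], [lin_sym_ge2] and
   [homog_gen_lin]. *)
Definition cast_gen (i j : nat) (x : E j) : E i :=
  if @eqP _ j i is ReflectT e then ecast k (E k) e x else 0.

Fixpoint lin_t (i : nat) (s : sterm) : E i :=
  match s with
  | Cst _ => 0
  | Gen j x => cast_gen i x
  | Add s t => lin_t i s + lin_t i t
  | Mul s t => aug_t s *: lin_t i t + aug_t t *: lin_t i s
  end.

Lemma cast_gen_id i (x : E i) : cast_gen i x = x.
Proof. by rewrite /cast_gen; case: eqP => // e; rewrite eq_axiomK. Qed.

Lemma cast_gen_neq i j (x : E j) : j != i -> cast_gen i x = 0.
Proof. by rewrite /cast_gen; case: eqP. Qed.

Lemma cast_gen_is_linear i j : linear (@cast_gen i j).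
Proof.
move=> a x y; case: (eqVneq j i) => [e|ne].
  by case: i / e; rewrite !cast_gen_id.
by rewrite !cast_gen_neq // scaler0 addr0.
Qed.

Lemma lin_t_cong i s t : scong s t -> lin_t i s = lin_t i t.
Proof.
elim=> {s t} //=.
- by move=> s t u _ -> _ ->.
- by move=> s s' t t' _ -> _ ->.
- by move=> s s' t t' /aug_t_cong -> -> /aug_t_cong -> ->.
- by move=> s t u; rewrite addrA.
- by move=> s t; rewrite addrC.
- by move=> s; rewrite add0r.
- move=> s t u; rewrite !scalerDr !scalerA -!addrA.
  by congr (_ + (_ + _)); congr (_ *: _); rewrite // mulrC.
- by move=> s; rewrite scale1r scaler0 addr0.
- by move=> s; rewrite scale0r scaler0 addr0.
- by move=> s t u; rewrite scalerDl scalerDr addrACA.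
- by move=> s t u; rewrite scalerDl scalerDr addrACA.
- by rewrite addr0.
- by move=> a b; rewrite !scaler0 addr0.
- by move=> a s; rewrite addrC.
- by move=> a j x y; rewrite cast_gen_is_linear scaler0 addr0.
- by move=> j k x y; rewrite !(scale0r, mulr0, scaler0, addr0).
Qed.

Definition lin (i : nat) (u : symalg) : E i := lin_t i (srp u).

Lemma lin_scl i s : lin i (scl s) = lin_t i s.
Proof. exact/lin_t_cong/srp_scl. Qed.

Lemma lin_is_linear i : linear (lin i).
Proof.
move=> a u v; rewrite sym_scaleE -[u]srpK -[v]srpK -sclM -sclD !lin_scl /=.
by rewrite scaler0 addr0.
Qed.
HB.instance Definition _ i :=
  GRing.isLinear.Build O symalg (E i) _ (lin i) (lin_is_linear i).

Lemma linM i u v : lin i (u * v) = aug u *: lin i v + aug v *: lin i u.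
Proof. by rewrite -[u]srpK -[v]srpK -sclM !lin_scl !aug_scl. Qed.

Lemma lin_gen i (x : E i) : lin i (gen x) = x.
Proof. by rewrite lin_scl /= cast_gen_id. Qed.

Lemma lin_gen_neq i j (x : E j) : j != i -> lin i (gen x) = 0.
Proof. by rewrite lin_scl; exact: cast_gen_neq. Qed.

Lemma lin_cst i a : lin i a%:A = 0.
Proof. by rewrite -scl_cst lin_scl. Qed.

Lemma lin_sym_ge2 i s : s \in sym_ge2 -> lin i s = 0.
Proof.
move=> /lspanP; elim=> [|a x y [[|z [|z' w]] //= _ ->] _ ih].
  exact: linear0.
rewrite linearP /= ih monom_cons linM aug_gen aug_monom_cons !scale0r.
by rewrite !(addr0, scaler0).
Qed.

Lemma lin_homog0 i s : s \in homog 0 -> lin i s = 0.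
Proof. by move=> /homog0_cst ->; exact: lin_cst. Qed.

Lemma homog_gen_lin n s : s \in homog n.+1 -> s - gen (lin n s) \in sym_ge2.
Proof.
move=> /lspanP; elim=> [|a x y [w wn ->] _ ih].
  by rewrite !linear0 addr0; exact: rpred0.
rewrite !linearP /= addrACA -scalerDr; apply: rpredD => //.
apply: rpredZ; case: w wn => [|[j z] [|z' w]].
- by rewrite /wdeg big_nil.
- rewrite /wdeg big_seq1 /= => -[ej]; case: n / ej ih => _.
  by rewrite monom_seq1 lin_gen subrr; exact: rpred0.
- move=> _; have h : monom [:: Tagged E z, z' & w] \in sym_ge2.
    by apply: mem_lspan; exists [:: Tagged E z, z' & w].
  by rewrite (lin_sym_ge2 _ h) !linear0 addr0.
Qed.

(* A linear map killing S^{>= 2}(E) factors through the projection. *)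
Lemma lin_factor (M : lmodType O) (g : {linear symalg -> M}) :
  (forall s, s \in sym_ge2 -> g s = 0) ->
  forall n s, s \in homog n.+1 -> g (gen (lin n s)) = g s.
Proof.
move=> g0 n s /homog_gen_lin/g0/eqP; rewrite linearB subr_eq0.
by move/eqP.
Qed.

End SymAlg.
Arguments homog {O} E n _.
Arguments sym_ge2 {O} E _.

Record koszul_tate (O : comNzRingType) (I : idealr O) := KoszulTate {
  kt_gen : nat -> lmodType O;
  kt_proj : forall i, projective (kt_gen i);
  kt_d : {linear symalg kt_gen -> symalg kt_gen};
  kt_homog0 : forall s, s \in homog kt_gen 0 -> kt_d s = 0;
  kt_homogS : forall n s,
    s \in homog kt_gen n.+1 -> kt_d s \in homog kt_gen n;
  kt_leibniz : forall n s t, s \in homog kt_gen n ->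
    kt_d (s * t) = kt_d s * t + (-1) ^+ n * (s * kt_d t);
  kt_square : forall s, kt_d (kt_d s) = 0;
  kt_exact : forall n s, s \in homog kt_gen n.+1 -> kt_d s = 0 ->
    exists2 t, t \in homog kt_gen n.+2 & kt_d t = s;
  (* H_0 = O / I: the degree 0 component is O, and its boundaries are I. *)
  kt_H0 : forall a : O,
    (exists2 t, t \in homog kt_gen 1 & kt_d t = a%:A) <-> a \in I }.
Arguments kt_gen {O I} k i.
Arguments kt_d {O I} k.

Record dg_morphism (O : comNzRingType) (I : idealr O) (T T' : koszul_tate I) :=
  DgMorphism {
    dg_fun :> {lrmorphism symalg (kt_gen T) -> symalg (kt_gen T')};
    dg_homog : forall n s,
      s \in homog (kt_gen T) n -> dg_fun s \in homog (kt_gen T') n;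
    dg_comm : forall s, dg_fun (kt_d T s) = kt_d T' (dg_fun s) }.

Section Reduced.
Variables (O : comNzRingType) (I : idealr O).

Definition ideal_mod (M : lmodType O) : {pred M} :=
  lspan (fun y => exists2 a, a \in I & exists x : M, y = a *: x).
HB.instance Definition _ M := GRing.SubmodClosed.on (@ideal_mod M).

Lemma ideal_modZ (M : lmodType O) a (x : M) :
  a \in I -> a *: x \in @ideal_mod M.
Proof. by move=> aI; apply: mem_lspan; exists a => //; exists x. Qed.

(* M \otimes_O O/I, as M / I M. *)
Definition redmod (M : lmodType O) : lmodType O := quot_mod (@ideal_mod M).

Definition rclass (M : lmodType O) : {linear M -> redmod M} :=
  @qclass O M (@ideal_mod M).

Lemma rclassK (M : lmodType O) (q : redmod M) : exists x, q = rclass M x.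
Proof. by eexists; symmetry; exact: qclass_repr. Qed.

Section RedMap.
Variables (E F : nat -> lmodType O) (f : {linear symalg E -> symalg F}).
Variables (i j : nat).

Definition pre_red_map : {linear E i -> redmod (F j)} :=
  rclass (F j) \o lin j \o f \o @gen O E i.

Lemma pre_red_mapI x : x \in @ideal_mod (E i) -> pre_red_map x = 0.
Proof.
move=> /lspanP; elim=> [|a y z [b bI [u ->]] _ ih]; first exact: linear0.
rewrite linearP ih addr0 -[RHS](scaler0 _ a); congr (_ *: _).
have -> : pre_red_map (b *: u) = rclass (F j) (b *: lin j (f (gen u))).
  by rewrite /= !linearZ_LR.
exact/qclass0/ideal_modZ.
Qed.

(* The map E i / I E i -> F j / I F j induced by the E i -> F j component of
   f modulo S^{>= 2}(F). *)
Definition red_map : {linear redmod (E i) -> redmod (F j)} :=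
  quot_lift pre_red_mapI.

Lemma red_mapE x : red_map (rclass (E i) x) = rclass (F j) (lin j (f (gen x))).
Proof. exact: (quot_liftE pre_red_mapI). Qed.
End RedMap.

Lemma monom_homog (E : nat -> lmodType O) w :
  monom w \in homog E (wdeg w).
Proof. by apply: mem_lspan; exists w. Qed.

Lemma kt_aug (T : koszul_tate I) n s :
  s \in homog (kt_gen T) n -> aug (kt_d T s) \in I.
Proof.
case: n => [|[|n]] hs.
- by rewrite (kt_homog0 hs) linear0; exact: rpred0.
- apply/kt_H0; exists s => //; apply: homog0_cst; exact: kt_homogS.
- by rewrite (homog_aug0 (kt_homogS hs)); exact: rpred0.
Qed.

Lemma kt_ge2 (T : koszul_tate I) n s : s \in sym_ge2 (kt_gen T) ->
  rclass (kt_gen T n) (lin n (kt_d T s)) = 0.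
Proof.
move=> /lspanP; elim=> [|a x y [[|z [|z' w]] //= _ ->] _ ih].
  by rewrite !linear0.
rewrite !linearP /= ih addr0 monom_cons (kt_leibniz _ (gen_homog _)).
rewrite -[RHS](scaler0 _ a); congr (_ *: _).
have -> u : (-1) ^+ (tag z).+1 * u = (-1) ^+ (tag z).+1 *: u :> symalg (kt_gen T).
  by rewrite -[in RHS](mul1r u) scalerAl -signr_odd -[in RHS]signr_odd; case: odd;
     rewrite ?expr1 ?expr0 ?scaleN1r ?scale1r.
rewrite 2!linearD linearZ /= !linM aug_monom_cons aug_gen !scale0r addr0 add0r.
rewrite [X in _ + X]linearZ /= -[RHS]addr0; congr (_ + _).
  by apply/qclass0/ideal_modZ; exact: kt_aug (gen_homog _).
rewrite -[RHS](scaler0 _ ((-1) ^+ (tag z).+1)); congr (_ *: _).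
by apply/qclass0/ideal_modZ; exact: kt_aug (monom_homog _).
Qed.

Lemma kt_factor (T : koszul_tate I) n s : s \in homog (kt_gen T) n.+2 ->
  rclass (kt_gen T n) (lin n (kt_d T (gen (lin n.+1 s))))
  = rclass (kt_gen T n) (lin n (kt_d T s)).
Proof.
apply: (@lin_factor _ _ _ (rclass (kt_gen T n) \o lin n \o kt_d T)).
exact: kt_ge2.
Qed.

Lemma dg_ge2 (T T' : koszul_tate I) (phi : dg_morphism T T') n s :
  s \in sym_ge2 (kt_gen T) -> lin n (phi s) = 0.
Proof.
move=> /lspanP; elim=> [|a x y [[|z [|z' w]] //= _ ->] _ ih].
  by rewrite !linear0.
rewrite !linearP /= ih addr0 !monom_cons !rmorphM /= !linM augM.
rewrite !(homog_aug0 (dg_homog phi (gen_homog _))).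
by rewrite mul0r !scale0r addr0 scaler0.
Qed.

Lemma dg_factor (T T' : koszul_tate I) (phi : dg_morphism T T') n s :
  s \in homog (kt_gen T) n.+1 -> lin n (phi (gen (lin n s))) = lin n (phi s).
Proof. exact: (@lin_factor _ _ _ (lin n \o phi) (@dg_ge2 _ _ phi n)). Qed.

Definition red_d (T : koszul_tate I) n :
    {linear redmod (kt_gen T n.+1) -> redmod (kt_gen T n)} :=
  red_map (kt_d T) n.+1 n.

Lemma red_dd (T : koszul_tate I) n x : red_d T n (red_d T n.+1 x) = 0.
Proof.
have [{}x ->] := rclassK x; rewrite /red_d !red_mapE.
rewrite kt_factor ?kt_square ?linear0 //.
exact/kt_homogS/gen_homog.
Qed.

Definition reduced_complex (T : koszul_tate I) : chain_complex O :=
  @ChainComplex O (fun n => redmod (kt_gen T n)) (red_d T) (@red_dd T).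

Section ReducedMap.
Variables (T T' : koszul_tate I) (phi : dg_morphism T T').

Lemma red_comm n x :
  red_map phi n n (red_d T n x) = red_d T' n (red_map phi n.+1 n.+1 x).
Proof.
have [{}x ->] := rclassK x; rewrite /red_d !red_mapE.
rewrite dg_factor; last exact/kt_homogS/gen_homog.
rewrite kt_factor ?dg_comm //; exact/dg_homog/gen_homog.
Qed.

Definition reduced_map : chain_map (reduced_complex T) (reduced_complex T') :=
  @ChainMap O (reduced_complex T) (reduced_complex T')
    (fun n => red_map phi n n) red_comm.
End ReducedMap.

End Reduced.

(* Main.v *)
Require Import Defs.
From HB Require Import structures.
From mathcomp Require Import all_boot all_algebra.
From mathcomp Require Import boolp.
Import GRing.Theory.
Local Open Scope ring_scope.

Set Implicit Arguments.
Unset Strict Implicit.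
Unset Printing Implicit Defensive.

(* An algebra morphism out of S(E) is a graded-commuting family of linear maps
   on the E i, so a dg morphism out of a Koszul-Tate resolution can be built
   degree by degree, each step being a lifting problem that is solved by
   projectivity of E i and acyclicity of the target.  With target S(E') this
   gives a dg morphism S(E) -> S(E').  With target the path algebra
   S(E') (x) K[t, dt], relative to evaluation at t = 0 and t = 1, it connects any
   two dg morphisms psi, phi by an algebra morphism phi_t together with a
   phi_t-derivation h_t satisfying d/dt phi_t = d' h_t + h_t d.  Integrating over
   [0, 1], which needs characteristic 0, H := \int h_t is a homotopy from psi to
   phi which preserves S^{>= 2}, and so descends to the reduced complexes.  Hence
   all dg morphisms induce the same homotopy class there, and functoriality makes
   it a class of homotopy equivalences. *)

Lemma scale_sign (R : pzRingType) (A : lalgType R) n (u : A) :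
  (-1) ^+ n *: u = (-1) ^+ n * u.
Proof. by rewrite -signr_odd -[in RHS]signr_odd scaler_sign mulr_sign. Qed.

(** * The symmetric algebra as the free graded-commutative algebra *)

Section UniversalProperty.
Variables (O : comNzRingType) (E : nat -> lmodType O) (B : algType O).

Fixpoint eval_t (f : forall i, {linear E i -> B}) (s : sterm E) : B :=
  match s with
  | Cst a => a%:A
  | Gen i x => f i x
  | Add s t => eval_t f s + eval_t f t
  | Mul s t => eval_t f s * eval_t f t
  end.

Definition graded_commuting (f : forall i, {linear E i -> B}) : Prop :=
  forall i j (x : E i) (y : E j),
    f i x * f j y = (-1) ^+ (i.+1 * j.+1) *: (f j y * f i x).

Variables (f : forall i, {linear E i -> B}) (fC : graded_commuting f).

Lemma eval_t_cong s t : scong s t -> eval_t f s = eval_t f t.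
Proof.
elim=> {s t} //=.
- by move=> s t u _ -> _ ->.
- by move=> s s' t t' _ -> _ ->.
- by move=> s s' t t' _ -> _ ->.
- by move=> s t u; rewrite addrA.
- by move=> s t; rewrite addrC.
- by move=> s; rewrite scale0r add0r.
- by move=> s t u; rewrite mulrA.
- by move=> s; rewrite scale1r mul1r.
- by move=> s; rewrite scale0r mul0r.
- by move=> s t u; rewrite mulrDl.
- by move=> s t u; rewrite mulrDr.
- by move=> a b; rewrite scalerDl.
- by move=> a b; rewrite -scalerAl mul1r scalerA.
- by move=> a s; rewrite -scalerAl -scalerAr mul1r mulr1.
- by move=> a i x y; rewrite linearP -scalerAl mul1r.
- by move=> i j x y; rewrite fC -scalerAl mul1r.
Qed.

(** The proof of graded commutation is kept as an argument, so that the linear and multiplicative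
    structures declared below can be attached to [sym_ext fC]. *)
Definition sym_ext (_ : graded_commuting f) (u : symalg E) : B :=
  eval_t f (srp u).

Lemma sym_ext_scl s : sym_ext fC (scl s) = eval_t f s.
Proof. exact/eval_t_cong/srp_scl. Qed.

Lemma sym_ext_is_linear : linear (sym_ext fC).
Proof.
move=> a u v; rewrite sym_scaleE -[u]srpK -[v]srpK -sclM -sclD !sym_ext_scl /=.
by rewrite -scalerAl mul1r.
Qed.
HB.instance Definition _ :=
  GRing.isLinear.Build O (symalg E) B _ (sym_ext fC) sym_ext_is_linear.

Lemma sym_ext_is_monoid_morphism : monoid_morphism (sym_ext fC).
Proof.
split=> [|u v]; first by rewrite -[1]scale1r -scl_cst sym_ext_scl /= scale1r.
by rewrite -[u]srpK -[v]srpK -sclM !sym_ext_scl.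
Qed.
HB.instance Definition _ :=
  GRing.isMonoidMorphism.Build (symalg E) B (sym_ext fC)
    sym_ext_is_monoid_morphism.

Lemma sym_ext_gen i (x : E i) : sym_ext fC (gen x) = f i x.
Proof. exact: sym_ext_scl. Qed.

End UniversalProperty.

(** * Words, degrees and Koszul signs *)

Section Monomials.
Variables (O : comNzRingType) (E : nat -> lmodType O).
Implicit Types (w : seq {i & E i}) (s t u : symalg E).

Lemma monom_cat w1 w2 : monom (w1 ++ w2) = monom w1 * monom w2.
Proof. by rewrite /monom big_cat. Qed.

Lemma wdeg_cat w1 w2 : wdeg (w1 ++ w2) = (wdeg w1 + wdeg w2)%N.
Proof. by rewrite /wdeg big_cat. Qed.

Lemma wdeg_cons x w : wdeg (x :: w) = ((tag x).+1 + wdeg w)%N.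
Proof. by rewrite /wdeg big_cons. Qed.

Lemma homog_ind n (P : symalg E -> Prop) :
  P 0 -> (forall a s t, P s -> P t -> P (a *: s + t)) ->
  (forall w, wdeg w = n -> P (monom w)) -> forall s, s \in homog E n -> P s.
Proof.
move=> P0 PD Pm s /lspanP; elim=> // a x y [w wn ->] _ Py.
exact: PD (Pm _ wn) Py.
Qed.

Lemma homog1 : 1 \in homog E 0.
Proof.
rewrite -(monom_nil E); apply: mem_lspan.
by exists [::]; rewrite // /wdeg big_nil.
Qed.

Lemma homogM m n s t :
  s \in homog E m -> t \in homog E n -> s * t \in homog E (m + n).
Proof.
move=> hs ht; move: s hs; apply: homog_ind => [|a s s' hs hs'|w wm].
- by rewrite mul0r rpred0.
- by rewrite mulrDl -scalerAl rpredD // rpredZ.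
move: t ht; apply: homog_ind => [|a t t' ht ht'|w' wn].
- by rewrite mulr0 rpred0.
- by rewrite mulrDr -scalerAr rpredD // rpredZ.
by rewrite -monom_cat -wm -wn -wdeg_cat; apply: monom_homog.
Qed.

Lemma monom_comm w1 w2 :
  monom w1 * monom w2 = (-1) ^+ (wdeg w1 * wdeg w2) *: (monom w2 * monom w1).
Proof.
have gen_monom i (x : E i) w :
    gen x * monom w = (-1) ^+ (i.+1 * wdeg w) *: (monom w * gen x).
  elim: w => [|[j y] w ih].
    by rewrite monom_nil /wdeg big_nil muln0 mul1r mulr1 scale1r.
  rewrite monom_cons wdeg_cons /= mulrA gen_comm -scalerAl -[in LHS]mulrA ih.
  by rewrite -scalerAr scalerA mulrA mulnDr exprD.
elim: w1 => [|[i x] w1 ih].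
  by rewrite monom_nil /wdeg big_nil mul0n mul1r mulr1 scale1r.
rewrite monom_cons wdeg_cons /= -mulrA ih -scalerAr [in LHS]mulrA.
rewrite [gen x * monom w2]gen_monom -scalerAl scalerA.
by rewrite -[in LHS]mulrA mulnDl exprD [X in X *: _ = _]mulrC.
Qed.

Lemma homog_comm m n s t : s \in homog E m -> t \in homog E n ->
  s * t = (-1) ^+ (m * n) *: (t * s).
Proof.
move=> hs ht; move: s hs; apply: homog_ind => [|a s s' hs hs'|w wm].
- by rewrite mul0r mulr0 scaler0.
- rewrite mulrDl mulrDr -scalerAl -scalerAr hs hs' scalerDr !scalerA.
  by rewrite [a * _]mulrC.
move: t ht; apply: homog_ind => [|a t t' ht ht'|w' wn].
- by rewrite mul0r mulr0 scaler0.
- rewrite mulrDl mulrDr -scalerAl -scalerAr ht ht' scalerDr !scalerA.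
  by rewrite [a * _]mulrC.
by rewrite -wm -wn monom_comm.
Qed.

(** Words span the algebra: constants are multiples of the empty word, generators are words of
    length one, and a product of words is their concatenation. *)
Lemma sym_ind (P : symalg E -> Prop) :
  P 0 -> (forall a s t, P s -> P t -> P (a *: s + t)) ->
  (forall w, P (monom w)) -> forall s, P s.
Proof.
move=> P0 PD Pm s; pose D u := exists2 w, True & u = monom w.
suff : s \in lspan D.
  by move=> /lspanP; elim=> // a x y [w _ ->] _ Py; exact: PD (Pm w) Py.
have Dm w : monom w \in lspan D by apply: mem_lspan; exists w.
rewrite -[s]srpK; elim: (srp s) => {s} [a|i x|s hs t ht|s hs t ht].
- by rewrite scl_cst -(monom_nil E) rpredZ.
- by have := Dm [:: Tagged E x]; rewrite monom_seq1.
- by rewrite sclD rpredD.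
rewrite sclM; move/lspanP: hs; elim=> [|a x y [w _ ->] _ ih].
  by rewrite mul0r; exact: (rpred0 (lspan D)).
rewrite mulrDl -scalerAl rpredD // rpredZ //.
move/lspanP: ht; elim=> [|b x' y' [w' _ ->] _ ih'].
  by rewrite mulr0; exact: (rpred0 (lspan D)).
by rewrite mulrDr -scalerAr -monom_cat rpredD // rpredZ.
Qed.

(** A word of positive degree is nonempty, so a concatenation of two such words has at least two
    letters. *)
Lemma homogM_ge2 m n s t :
  s \in homog E m.+1 -> t \in homog E n.+1 -> s * t \in sym_ge2 E.
Proof.
move=> hs ht; move: s hs; apply: homog_ind => [|a s s' hs hs'|w wm].
- by rewrite mul0r rpred0.
- by rewrite mulrDl -scalerAl rpredD // rpredZ.
move: t ht; apply: homog_ind => [|a t t' ht ht'|w' wn].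
- by rewrite mulr0 rpred0.
- by rewrite mulrDr -scalerAr rpredD // rpredZ.
rewrite -monom_cat; apply: mem_lspan; exists (w ++ w') => //.
case: w w' wm wn => [|z w] [|z' w']; rewrite /wdeg ?big_nil // => _ _.
by rewrite size_cat addnS.
Qed.

End Monomials.

(** * Lifting from a projective module into a submodule *)

Section RelativeLift.
Variables (R : pzRingType) (P M N : lmodType R) (S : submodClosed M).
Variables (g : {linear M -> N}) (f : {linear P -> N}).

Definition is_pullback : {pred M * P} :=
  fun z => (z.1 \in S) && (g z.1 == f z.2).

Lemma is_pullback_submod_closed : submod_closed is_pullback.
Proof.
split=> [|a x y]; rewrite !unfold_in /is_pullback /=.
  apply/andP; split; first exact: (rpred0 S).
  by apply/eqP; rewrite [LHS]linear0 [RHS]linear0.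
move=> /andP[xS /eqP xE] /andP[yS /eqP yE].
apply/andP; split; first by apply: (rpredD (S := S)) => //; apply: (rpredZ (s := S)).
by rewrite !linearP xE yE eqxx.
Qed.
HB.instance Definition _ :=
  GRing.isSubmodClosed.Build R (M * P)%type is_pullback is_pullback_submod_closed.

Record pullback : Type := Pullback {
  pullback_val : (M * P)%type;
  pullback_valP : pullback_val \in is_pullback }.
HB.instance Definition _ := [isSub for pullback_val].
HB.instance Definition _ := [Choice of pullback by <:].
HB.instance Definition _ := [SubChoice_isSubLmodule of pullback by <:].

Definition pullback_snd (z : pullback) : P := (pullback_val z).2.
Lemma pullback_snd_is_linear : linear pullback_snd.
Proof. by []. Qed.
HB.instance Definition _ :=
  GRing.isLinear.Build R pullback P _ pullback_snd pullback_snd_is_linear.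

Definition pullback_fst (z : pullback) : M := (pullback_val z).1.
Lemma pullback_fst_is_linear : linear pullback_fst.
Proof. by []. Qed.
HB.instance Definition _ :=
  GRing.isLinear.Build R pullback M _ pullback_fst pullback_fst_is_linear.

(** [g] may fail to be onto [N], so projectivity is applied to the projection of the fibre product
    of [S] and [P] over [N] onto [P], which [fS] makes surjective. A section of it, followed by the
    first projection, is the lift. *)
Lemma projective_lift_in : projective P ->
  (forall x, exists2 y, y \in S & g y = f x) ->
  exists h : {linear P -> M}, forall x, h x \in S /\ g (h x) = f x.
Proof.
move=> projP fS.
have snd_surj x : exists z, pullback_snd z = x.
  have [y yS yE] := fS x.
  have zP : (y, x) \in is_pullback by rewrite unfold_in /is_pullback /= yS yE /=.
  by exists (Pullback zP).
have [h hE] := projP _ _ pullback_snd idfun snd_surj.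
exists (pullback_fst \o h) => x /=.
have := pullback_valP (h x); rewrite unfold_in => /andP[hS /eqP gE].
by split => //; rewrite gE; congr (f _); exact: hE.
Qed.
End RelativeLift.

(* The differential is not required to lower the degree: that of the path
   algebra maps degree 0 to the degree -1 component S_0[t] dt, which [dga_grade]
   does not record. *)
Record dg_algebra (O : comNzRingType) := DgAlgebra {
  dga_alg :> algType O;
  dga_grade : nat -> submodClosed dga_alg;
  dga_d : {linear dga_alg -> dga_alg};
  dga_grade1 : 1 \in dga_grade 0;
  dga_gradeM : forall m n u v,
    u \in dga_grade m -> v \in dga_grade n -> u * v \in dga_grade (m + n);
  dga_comm : forall m n u v, u \in dga_grade m -> v \in dga_grade n ->
    u * v = (-1) ^+ (m * n) *: (v * u);
  dga_leibniz : forall n u v, u \in dga_grade n ->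
    dga_d (u * v) = dga_d u * v + (-1) ^+ n *: (u * dga_d v) }.
Arguments dga_grade {O} d n.
Arguments dga_d {O} d.

Lemma dga_d1 (O : comNzRingType) (B : dg_algebra O) : dga_d B 1 = 0.
Proof.
have := dga_leibniz 1 (dga_grade1 B); rewrite !mulr1 mul1r expr0 scale1r.
by rewrite -[LHS]addr0 => /addrI.
Qed.

(** * Building dg morphisms out of a resolution, one generator degree at a time *)

Section Lifting.
Variables (O : comNzRingType) (I : idealr O) (T : koszul_tate I).
Variables (B : dg_algebra O).
Local Notation E := (kt_gen T).
Local Notation "'\d' x" := (kt_d T (gen x)) (at level 10).

Section Extension.
Variables (f : forall i, {linear E i -> B}).
Hypothesis fG : forall i x, f i x \in dga_grade B i.+1.

Lemma grade_commuting : graded_commuting f.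
Proof. by move=> i j x y; exact: dga_comm. Qed.

Let Phi : {lrmorphism symalg E -> B} := sym_ext grade_commuting.

Lemma sym_ext_grade n s : s \in homog E n -> Phi s \in dga_grade B n.
Proof.
move: s; apply: homog_ind => [|a s t hs ht|w <-].
- by rewrite linear0; exact: (rpred0 (dga_grade B n)).
- rewrite linearP; apply: (rpredD (S := dga_grade B n)) => //.
  exact: (rpredZ (s := dga_grade B n)).
elim: w => [|[i x] w ih].
  by rewrite monom_nil rmorph1 /wdeg big_nil; exact: dga_grade1.
rewrite monom_cons wdeg_cons rmorphM; apply: dga_gradeM ih.
by rewrite /= sym_ext_gen.
Qed.
End Extension.

Section Commutation.
Variables (Phi : {lrmorphism symalg E -> B}).
Hypothesis PhiG : forall n s, s \in homog E n -> Phi s \in dga_grade B n.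

(** Both sides obey the Leibniz rule along [Phi], so agreement on letters is enough. Only the
    letters of [w] are asked for, which lets the lemma serve while [Phi] is still under
    construction. *)
Lemma commutation_monom w :
  (forall i (x : E i), Tagged E x \in w -> dga_d B (Phi (gen x)) = Phi (\d x)) ->
  dga_d B (Phi (monom w)) = Phi (kt_d T (monom w)).
Proof.
elim: w => [|[i x] w ih] Phid.
  by rewrite monom_nil rmorph1 dga_d1 (kt_homog0 (homog1 _)) rmorph0.
rewrite monom_cons (kt_leibniz _ (gen_homog x)) rmorphD !rmorphM.
rewrite (dga_leibniz _ (PhiG (gen_homog x))) Phid ?mem_head // ih; last first.
  by move=> j y yw; apply: Phid; rewrite inE yw orbT.
by rewrite scale_sign rmorphXn rmorphN rmorph1 !mulrA.
Qed.
End Commutation.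

Lemma tag_wdeg w i (x : E i) : Tagged E x \in w -> (i < wdeg w)%N.
Proof.
elim: w => [|y w ih] //; rewrite inE wdeg_cons => /predU1P[<-|/ih h] /=.
  exact: leq_addr.
exact: leq_trans h (leq_addl _ _).
Qed.

Variables (C : lmodType O) (p : {linear B -> C}).
Variables (g : forall i, {linear E i -> C}).

(** The degree condition is imposed for every index, so that each intermediate family extends to an
    algebra morphism; the equations are imposed only below [n]. The term [eval_t f (srp _)] is that
    extension, written without the commutation proof that [sym_ext] carries. *)
Definition lifts_below n (f : forall i, {linear E i -> B}) : Prop :=
  (forall i x, f i x \in dga_grade B i.+1) /\
  (forall i x, (i < n)%N ->
     dga_d B (f i x) = eval_t f (srp (\d x)) /\ p (f i x) = g i x).

Definition lift_pair (b : B) : (B * C)%type := (dga_d B b, p b).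
Lemma lift_pair_is_linear : linear lift_pair.
Proof. by move=> a x y; rewrite /lift_pair !linearP. Qed.
HB.instance Definition _ :=
  GRing.isLinear.Build O B (B * C)%type _ lift_pair lift_pair_is_linear.

Section Target.
Variables (n : nat) (Phi : {lrmorphism symalg E -> B}).
Definition lift_target (x : E n) : (B * C)%type := (Phi (\d x), g n x).
Lemma lift_target_is_linear : linear lift_target.
Proof. by move=> a x y; rewrite /lift_target !linearP. Qed.
HB.instance Definition _ :=
  GRing.isLinear.Build O (E n) (B * C)%type _ lift_target lift_target_is_linear.
End Target.

(** Solvability for each single [x], with no linearity in [x]; projectivity of [E n] supplies the
    linear choice. *)
Hypothesis obstruction : forall n (Phi : {lrmorphism symalg E -> B}),
  (forall m s, s \in homog E m -> Phi s \in dga_grade B m) ->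
  (forall i (x : E i), (i < n)%N -> p (Phi (gen x)) = g i x) ->
  (forall m s, (m <= n)%N -> s \in homog E m -> dga_d B (Phi s) = Phi (kt_d T s)) ->
  forall x : E n, exists b,
    [/\ b \in dga_grade B n.+1, dga_d B b = Phi (\d x) & p b = g n x].

(** A generator of index [i] has degree [i.+1], so a word of degree [n] only has letters of index
    below [n]. *)
Lemma eval_homog_local n (f f' : forall i, {linear E i -> B})
    (fC : graded_commuting f) (fC' : graded_commuting f') :
  (forall i x, (i < n)%N -> f i x = f' i x) ->
  forall s, s \in homog E n -> sym_ext fC s = sym_ext fC' s.
Proof.
move=> ff'; apply: homog_ind => [|a s t hs ht|w wn].
- by rewrite !linear0.
- by rewrite !linearP /= hs ht.
have {wn} : forall i (x : E i), Tagged E x \in w -> f i x = f' i x.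
  by move=> i x /tag_wdeg; rewrite wn; exact: ff'.
elim: w => [|[i x] w ih] fw; first by rewrite monom_nil !rmorph1.
rewrite monom_cons !rmorphM /= !sym_ext_gen ih ?fw ?mem_head // => j y yw.
by apply: fw; rewrite inE yw orbT.
Qed.

(** The differential of a generator of index at most [n] has degree at most [n], so its image does
    not change when [f n] is replaced. The two equations at index [n] are solved together, as one
    lifting problem along [lift_pair]. *)
Lemma lift_step n f : lifts_below n f ->
  exists h : {linear E n -> B}, lifts_below n.+1 (dfwith f h).
Proof.
move=> [fG fE]; set Phi : {lrmorphism symalg E -> B} := sym_ext (grade_commuting fG).
have PhiG := sym_ext_grade fG.
have Phi_gen i (x : E i) : Phi (gen x) = f i x by exact: sym_ext_gen.
have Phid m s : (m <= n)%N -> s \in homog E m -> dga_d B (Phi s) = Phi (kt_d T s).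
  move=> lemn; move: s; apply: homog_ind => [|a s t hs ht|w wm].
  - by rewrite !linear0.
  - by rewrite !linearP /= hs ht.
  apply: (commutation_monom PhiG) => i x /tag_wdeg; rewrite wm => ltim.
  by rewrite Phi_gen; have [-> _] := fE i x (leq_trans ltim lemn).
have Phig i (x : E i) : (i < n)%N -> p (Phi (gen x)) = g i x.
  by rewrite Phi_gen => /fE-/(_ x)[].
have [|x|h hP] := @projective_lift_in _ _ _ _ (dga_grade B n.+1) lift_pair
  (@lift_target n Phi).
- exact: kt_proj.
- have [b [bG db pb]] := obstruction PhiG Phig Phid x.
  by exists b => //; exact: congr2 db pb.
exists h; set f' := dfwith f h.
have f'h : f' n = h by exact: dfwith_in.
have f'f i x : i != n -> f' i x = f i x.
  by move=> ni; rewrite /f' dfwith_out // eq_sym.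
have f'G i x : f' i x \in dga_grade B i.+1.
  have [ein|ni] := eqVneq i n; last by rewrite f'f.
  by subst i; rewrite f'h; have [] := hP x.
split=> // i x; rewrite ltnS => lein.
have -> : eval_t f' (srp (\d x)) = Phi (\d x).
  apply: (eval_homog_local (n := i) (grade_commuting f'G) (grade_commuting fG)).
    by move=> j y ltji; apply: f'f; rewrite neq_ltn (leq_trans ltji lein).
  exact: kt_homogS (gen_homog x).
move: lein; rewrite leq_eqVlt => /predU1P[ein|ltin].
  by subst i; rewrite f'h; have [_ [-> ->]] := hP x.
by rewrite f'f ?neq_ltn ?ltin //; exact: fE.
Qed.

Theorem dg_lift : exists Phi : {lrmorphism symalg E -> B},
  [/\ forall m s, s \in homog E m -> Phi s \in dga_grade B m,
      forall i (x : E i), p (Phi (gen x)) = g i x &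
      forall s, dga_d B (Phi s) = Phi (kt_d T s)].
Proof.
pose fam := forall i, {linear E i -> B}.
(* Stated for every family, with an arbitrary answer when [lifts_below] fails, so that choice yields
   a function that can be iterated. *)
have stepP n (f : fam) : exists h : {linear E n -> B},
    lifts_below n f -> lifts_below n.+1 (dfwith f h).
  have [/lift_step[h hP]|nf] := pselect (lifts_below n f); first by exists h.
  by exists (f n) => /nf.
have {stepP} /all_sig[step stepP] n :
    {h : fam -> {linear E n -> B} |
      forall f, lifts_below n f -> lifts_below n.+1 (dfwith f (h f))}.
  by have [h hP] := choice (stepP n); exists h.
pose F := fix F n : fam :=
  if n is m.+1 then dfwith (F m) (step m (F m)) else fun i => \0.
have FP n : lifts_below n (F n).
  by elim: n => [|n /stepP //]; split=> // i x; exact: (rpred0 (dga_grade B _)).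
have Flim n i : (i < n)%N -> F n i = F i.+1 i.
  elim: n => // n ih; rewrite ltnS leq_eqVlt => /predU1P[->//|ltin].
  by rewrite -(ih ltin) /= dfwith_out // neq_ltn ltin orbT.
(* Index [i] is set at stage [i.+1] and never changes afterwards, so the diagonal is the limit of
   the stages. *)
pose f : fam := fun i => F i.+1 i.
have fG i x : f i x \in dga_grade B i.+1 by exact: (FP i.+1).1.
have fd i (x : E i) : dga_d B (f i x) = sym_ext (grade_commuting fG) (\d x).
  rewrite ((FP i.+1).2 i x (leqnn _)).1.
  apply: (eval_homog_local (n := i) (grade_commuting (FP i.+1).1)).
    by move=> j y ltji; rewrite /f Flim // ltnS ltnW.
  exact: kt_homogS (gen_homog x).
have PhiG := sym_ext_grade fG.
exists (sym_ext (grade_commuting fG)); split=> // [i x|].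
  by rewrite /= sym_ext_gen ((FP i.+1).2 i x (leqnn _)).2.
apply: sym_ind => [|a s t hs ht|w]; first by rewrite !linear0.
  by rewrite !linearP /= hs ht.
by apply: (commutation_monom PhiG) => i x _; rewrite /= sym_ext_gen.
Qed.

End Lifting.

(** * Existence of dg morphisms between two resolutions *)

Section KoszulTate.
Variables (O : comNzRingType) (I : idealr O).
Implicit Types T : koszul_tate I.

Lemma kt_leibnizZ T n s t : s \in homog (kt_gen T) n ->
  kt_d T (s * t) = kt_d T s * t + (-1) ^+ n *: (s * kt_d T t).
Proof. by rewrite scale_sign; exact: kt_leibniz. Qed.

Definition kt_dga T : dg_algebra O :=
  @DgAlgebra O (symalg (kt_gen T)) (fun n => homog (kt_gen T) n) (kt_d T)
    (homog1 _) (@homogM _ _) (@homog_comm _ _) (@kt_leibnizZ T).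

(** Lifting with the trivial constraint: [p] and all [g i] are zero, so only the differential has to
    be matched. *)
Lemma dg_morphism_exists (T T' : koszul_tate I) : inhabited (dg_morphism T T').
Proof.
have [n Phi PhiG _ Phid x|Phi [PhiG _ Phid]] :=
  @dg_lift O I T (kt_dga T') O^o \0 (fun i => \0).
  have [b bG db] : exists2 b, b \in homog (kt_gen T') n.+1 &
      kt_d T' b = Phi (kt_d T (gen x)).
    (* For index 0, the differential of [x] is a constant lying in [I], hence a boundary in [T']
       too. For higher index, its image is a cycle of positive degree, hence a boundary by
       exactness. *)
    case: n => [|n] in Phid x *.
      have x1 := gen_homog x.
      have dx : kt_d T (gen x) = (aug (kt_d T (gen x)))%:A.
        exact/homog0_cst/(kt_homogS x1).
      rewrite dx linearZ /= rmorph1; apply/(kt_H0 T').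
      exact: kt_aug x1.
    have x1 := gen_homog x.
    apply: kt_exact; first exact/PhiG/(kt_homogS x1).
    by rewrite [LHS](Phid n.+1) ?kt_square ?rmorph0 //; exact: kt_homogS x1.
  by exists b.
by constructor; exact: (@DgMorphism O I T T' Phi PhiG (fun s => esym (Phid s))).
Qed.
End KoszulTate.

(** * Formal integration of polynomials *)

Section PolyCalculus.
Variables (O : comNzRingType) (A : algType O).
Variables (inv : nat -> O) (invK : forall n, n.+1%:R * inv n = 1).

(** The primitive vanishing at 0, [inv j] being the inverse of [j.+1]. Its value at 1 is the
    integral over [0, 1]. *)
Definition prim (p : {poly A}) : {poly A} :=
  \poly_(i < (size p).+1) (if i is j.+1 then inv j *: p`_j else 0).

Lemma coef_prim p i : (prim p)`_i = if i is j.+1 then inv j *: p`_j else 0.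
Proof.
rewrite coef_poly; case: i => [|i] //; rewrite ltnS; case: ltnP => // h.
by rewrite nth_default ?scaler0.
Qed.

Lemma prim_is_additive : zmod_morphism prim.
Proof.
move=> p q; apply/polyP => -[|i]; rewrite coefB !coef_prim ?subr0 //.
by rewrite coefB scalerBr.
Qed.
HB.instance Definition _ :=
  GRing.isZmodMorphism.Build {poly A} {poly A} prim prim_is_additive.

Lemma deriv_prim p : (prim p)^`() = p.
Proof.
apply/polyP => i; rewrite coef_deriv coef_prim -scaler_nat scalerA invK.
exact: scale1r.
Qed.

Lemma prim_deriv p : prim p^`() = p - (p.[0])%:P.
Proof.
apply/polyP => -[|i]; rewrite coefB coefC coef_prim.
  by rewrite horner_coef0 subrr.
by rewrite coef_deriv subr0 -scaler_nat scalerA mulrC invK scale1r.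
Qed.

Lemma prim0 p : (prim p).[0] = 0.
Proof. by rewrite horner_coef0 coef_prim. Qed.

Definition coefs_in (S : submodClosed A) (p : {poly A}) : Prop :=
  forall i, p`_i \in S.

Lemma prim_coefs_in (S : submodClosed A) p : coefs_in S p -> coefs_in S (prim p).
Proof.
move=> pS [|i]; rewrite coef_prim; first exact: (rpred0 S).
exact: (rpredZ (s := S)).
Qed.

Lemma horner1_coefs_in (S : submodClosed A) p : coefs_in S p -> p.[1] \in S.
Proof.
move=> pS; rewrite horner_coef; apply: (rpred_sum (S := S)) => i _.
by rewrite expr1n mulr1.
Qed.

End PolyCalculus.

Lemma coef_sign (A : nzRingType) n (p : {poly A}) i :
  ((-1) ^+ n * p)`_i = (-1) ^+ n * p`_i.
Proof.
by rewrite -signr_odd -[in RHS]signr_odd !mulr_sign; case: odd; rewrite ?coefN.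
Qed.

(** * The path algebra of polynomial forms in t and dt *)

Section PathObject.
Variables (O : comNzRingType) (I : idealr O) (T : koszul_tate I).
Local Notation E := (kt_gen T).
Local Notation A := (symalg E).
Local Notation D := (map_poly (kt_d T)).
Implicit Types (p q : {poly A}).

Definition sign_gen i : {linear E i -> A} := (-1) ^+ i.+1 \*: @gen O E i.

Lemma sign_gen_commuting : graded_commuting sign_gen.
Proof.
move=> i j x y; rewrite /= -!scalerAl -!scalerAr !scalerA gen_comm scalerA.
by rewrite mulrC -mulrA [(-1) ^+ i.+1 * _]mulrC mulrA.
Qed.

(** Obtained from its values on generators, so that it is an algebra morphism on all of [A],
    inhomogeneous elements included. *)
Definition parity : A -> A := sym_ext sign_gen_commuting.
HB.instance Definition _ := GRing.LRMorphism.on parity.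

Lemma parity_homog n s : s \in homog E n -> parity s = (-1) ^+ n * s.
Proof.
rewrite -scale_sign; move: s; apply: homog_ind => [|a s t hs ht|w <-].
- by rewrite linear0 scaler0.
- by rewrite linearP /= hs ht scalerDr !scalerA [a * _]mulrC.
elim: w => [|[i x] w ih].
  by rewrite monom_nil rmorph1 /wdeg big_nil scale1r.
rewrite monom_cons wdeg_cons rmorphM /= ih [parity _]sym_ext_gen /=.
by rewrite -scalerAl -scalerAr scalerA exprD.
Qed.

Local Notation sg := (map_poly parity).

Lemma coefs_inM m n p q : coefs_in (homog E m) p -> coefs_in (homog E n) q ->
  coefs_in (homog E (m + n)) (p * q).
Proof. by move=> hp hq i; rewrite coefM rpred_sum // => j _; apply: homogM. Qed.

Lemma coefs_in_sign n k p :
  coefs_in (homog E n) p -> coefs_in (homog E n) ((-1) ^+ k * p).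
Proof. by move=> hp i; rewrite coef_sign -scale_sign rpredZ. Qed.

Lemma coefs_inD n p q : coefs_in (homog E n) p -> coefs_in (homog E n) q ->
  coefs_in (homog E n) (p + q).
Proof. by move=> hp hq i; rewrite coefD rpredD. Qed.

Lemma poly_homog_comm m n p q :
  coefs_in (homog E m) p -> coefs_in (homog E n) q ->
  p * q = (-1) ^+ (m * n) * (q * p).
Proof.
move=> hp hq; apply/polyP => i; rewrite coef_sign coefM coefMr mulr_sumr.
by apply: eq_bigr => j _; rewrite -scale_sign; apply: homog_comm.
Qed.

Lemma poly_leibniz n p q : coefs_in (homog E n) p ->
  D (p * q) = D p * q + (-1) ^+ n * (p * D q).
Proof.
move=> hp; apply/polyP => i.
rewrite coefD coef_sign coef_map /= !coefM linear_sum mulr_sumr -big_split /=.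
by apply: eq_bigr => j _; rewrite !coef_map; apply: kt_leibniz.
Qed.

Lemma parity_poly n p : coefs_in (homog E n) p -> sg p = (-1) ^+ n * p.
Proof.
move=> hp; apply/polyP => i; rewrite coef_sign coef_map.
exact: parity_homog.
Qed.

(** For positive [n], [D p] has degree n - 1, of the same parity as n + 1; for [n] equal to 0 it
    vanishes. *)
Lemma parity_poly_d n p : coefs_in (homog E n) p -> sg (D p) = (-1) ^+ n.+1 * D p.
Proof.
case: n => [|n] hp.
  have -> : D p = 0 by apply/polyP => i; rewrite coef_map coef0; apply: kt_homog0.
  by rewrite rmorph0 mulr0.
rewrite (@parity_poly n) => [|i]; first by rewrite !exprS !mulN1r opprK.
by rewrite coef_map; exact: kt_homogS.
Qed.

(* The pair (a, b) stands for a + dt b, with dt of degree -1; moving dt to the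
   left of a coefficient is what brings in [parity]. *)
Definition path_alg : Type := ({poly A} * {poly A})%type.
HB.instance Definition _ := GRing.Zmodule.on path_alg.
Implicit Types u v w : path_alg.

Definition path_mul u v : path_alg := (u.1 * v.1, u.2 * v.1 + sg u.1 * v.2).

Lemma path_mulA : associative path_mul.
Proof.
move=> u v w; rewrite /path_mul /= rmorphM /= !mulrDl !mulrDr !mulrA.
by rewrite addrA.
Qed.
Lemma path_mul1l : left_id (1, 0) path_mul.
Proof. by move=> [p q]; rewrite /path_mul /= rmorph1 !mul1r mul0r add0r. Qed.
Lemma path_mul1r : right_id (1, 0) path_mul.
Proof. by move=> [p q]; rewrite /path_mul /= !mulr1 mulr0 addr0. Qed.
Lemma path_mulDl : left_distributive path_mul +%R.
Proof.
move=> u v w; rewrite /path_mul /= rmorphD /= !mulrDl.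
by congr pair; rewrite /= addrACA.
Qed.
Lemma path_mulDr : right_distributive path_mul +%R.
Proof.
by move=> u v w; rewrite /path_mul /= !mulrDr; congr pair; rewrite /= addrACA.
Qed.
Lemma path_1neq0 : (1, 0) != 0 :> path_alg.
Proof. by apply/eqP => -[/eqP]; apply/negP; exact: oner_neq0. Qed.
HB.instance Definition _ := GRing.Zmodule_isNzRing.Build path_alg
  path_mulA path_mul1l path_mul1r path_mulDl path_mulDr path_1neq0.

Definition pcst (a : O) : {poly A} := (a%:A)%:P.

Lemma pcstC a p : pcst a * p = p * pcst a.
Proof.
by apply/polyP => i; rewrite coefCM coefMC mulr_algl mulr_algr.
Qed.

Lemma pcst_sign n : pcst ((-1) ^+ n) = (-1) ^+ n.
Proof. by rewrite /pcst scale_sign mulr1 rmorphXn rmorphN1. Qed.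

Lemma coef_pcstM a p i : (pcst a * p)`_i = a *: p`_i.
Proof. by rewrite coefCM mulr_algl. Qed.

Definition path_scale (a : O) u : path_alg := (pcst a * u.1, pcst a * u.2).

Lemma path_scaleA a b u : path_scale a (path_scale b u) = path_scale (a * b) u.
Proof.
by rewrite /path_scale /= !mulrA -polyCM -scalerAl mul1r scalerA.
Qed.
Lemma path_scale1 : left_id 1 path_scale.
Proof. by move=> [p q]; rewrite /path_scale /pcst scale1r !mul1r. Qed.
Lemma path_scaleDr : right_distributive path_scale +%R.
Proof. by move=> a u v; rewrite /path_scale !mulrDr. Qed.
Lemma path_scaleDl u : {morph path_scale^~ u : a b / a + b}.
Proof. by move=> a b; rewrite /path_scale /pcst scalerDl polyCD !mulrDl. Qed.
HB.instance Definition _ := GRing.Zmodule_isLmodule.Build O path_alg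
  path_scaleA path_scale1 path_scaleDr path_scaleDl.

Lemma path_scalerAl a u v : a *: (u * v) = a *: u * v.
Proof.
congr pair => /=; first by rewrite mulrA.
rewrite mulrDr rmorphM /= !mulrA; congr (_ + _ * _ * _).
by rewrite map_polyC /= linearZ rmorph1.
Qed.
HB.instance Definition _ := GRing.Lmodule_isLalgebra.Build O path_alg path_scalerAl.
Lemma path_scalerAr a u v : a *: (u * v) = u * (a *: v).
Proof.
by congr pair => /=; rewrite ?mulrDr !mulrA !(pcstC a).
Qed.
HB.instance Definition _ := GRing.Lalgebra_isAlgebra.Build O path_alg path_scalerAr.

(** On a + dt b, the derivative in t contributes dt a', and the minus sign comes from moving [D]
    past the odd element dt. *)
Definition path_d u : path_alg := (D u.1, u.1^`() - D u.2).
Lemma path_d_is_linear : linear path_d.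
Proof.
have DZ a p : D (pcst a * p) = pcst a * D p.
  by apply/polyP => i; rewrite coef_map coef_pcstM /= linearZ coef_pcstM coef_map.
move=> a u v; congr pair => /=; first by rewrite raddfD /= DZ.
rewrite derivD derivM derivC mul0r add0r !raddfD /= DZ mulrDr mulrN.
by rewrite addrACA.
Qed.
HB.instance Definition _ :=
  GRing.isLinear.Build O path_alg path_alg _ path_d path_d_is_linear.

(** Since dt has degree -1, its coefficient sits one degree higher. *)
Definition path_grade n : {pred path_alg} :=
  fun u => `[< coefs_in (homog E n) u.1 /\ coefs_in (homog E n.+1) u.2 >].
Lemma path_grade_submod_closed n : submod_closed (path_grade n).
Proof.
split=> [|a u v /asboolP[hu1 hu2] /asboolP[hv1 hv2]]; apply/asboolP; split=> i /=.
- by rewrite coef0 rpred0.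
- by rewrite coef0 rpred0.
- by rewrite coefD coef_pcstM rpredD // rpredZ.
- by rewrite coefD coef_pcstM rpredD // rpredZ.
Qed.
HB.instance Definition _ n :=
  GRing.isSubmodClosed.Build O path_alg (path_grade n) (path_grade_submod_closed n).

Lemma path_grade1 : 1 \in path_grade 0.
Proof.
apply/asboolP; split=> i; rewrite ?coef0 ?rpred0 // coef1.
by case: eqP => _; rewrite ?rpred0 // homog1.
Qed.

Lemma path_gradeM m n u v :
  u \in path_grade m -> v \in path_grade n -> u * v \in path_grade (m + n).
Proof.
move=> /asboolP[u1 u2] /asboolP[v1 v2]; apply/asboolP; split=> /=.
  exact: coefs_inM.
apply: coefs_inD; first by rewrite -addSn; exact: coefs_inM.
rewrite (parity_poly u1) -mulrA; apply: coefs_in_sign.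
by rewrite -addnS; exact: coefs_inM.
Qed.

Lemma path_comm m n u v : u \in path_grade m -> v \in path_grade n ->
  u * v = (-1) ^+ (m * n) *: (v * u).
Proof.
move=> /asboolP[u1 u2] /asboolP[v1 v2]; congr pair => /=; rewrite pcst_sign.
  exact: poly_homog_comm.
rewrite (parity_poly u1) (parity_poly v1) mulrDr addrC.
rewrite -!mulrA (poly_homog_comm u1 v2) (poly_homog_comm u2 v1) !mulrA -!exprD.
congr (_ * _ * _ + _ * _ * _); last by rewrite mulSn addnC.
by rewrite mulnS addnA addnn exprD -[_ ^+ m.*2]signr_odd odd_double mul1r.
Qed.

Lemma path_leibniz n u v : u \in path_grade n ->
  path_d (u * v) = path_d u * v + (-1) ^+ n *: (u * path_d v).
Proof.
move=> /asboolP[u1 u2]; congr pair => /=; rewrite pcst_sign.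
  exact: poly_leibniz.
rewrite derivM raddfD /= (poly_leibniz _ u2) (parity_poly u1) (parity_poly_d u1).
rewrite -[in LHS]mulrA.
have Dsg p : D ((-1) ^+ n * p) = (-1) ^+ n * D p.
  by apply/polyP => i; rewrite coef_map !coef_sign coef_map /= -!scale_sign linearZ.
rewrite Dsg (poly_leibniz _ u1) !exprS -signr_odd.
(* For either parity of [n], both sides expand to the same six terms up to order. *)
by case: (odd n); rewrite ?expr0 ?expr1
  !(mulN1r, mul1r, mulrDl, mulrDr, mulNr, mulrN, opprD, opprK)
  [LHS](AC (2 * (2 * 2)) ((1 * 3 * 5) * (4 * (2 * 6)))).
Qed.

Definition path_dga : dg_algebra O :=
  @DgAlgebra O path_alg path_grade path_d
    path_grade1 path_gradeM path_comm path_leibniz.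

Definition path_ends (u : path_alg) : (A * A)%type := (u.1.[0], u.1.[1]).

Lemma path_ends_is_linear : linear path_ends.
Proof.
by move=> a u v; congr pair; rewrite /= !(hornerD, hornerCM) mulr_algl.
Qed.
HB.instance Definition _ :=
  GRing.isLinear.Build O path_alg (A * A)%type _ path_ends path_ends_is_linear.

Lemma path_ends1 : path_ends 1 = (1, 1).
Proof. by rewrite /path_ends /= !hornerC. Qed.

Lemma path_endsM u v : path_ends (u * v) =
  ((path_ends u).1 * (path_ends v).1, (path_ends u).2 * (path_ends v).2).
Proof.
(* [A] is only graded commutative; evaluation is multiplicative at 0 and 1 because these points are
   central. *)
have c0 p : comm_poly p 0 by rewrite /comm_poly mul0r mulr0.
have c1 p : comm_poly p 1 by rewrite /comm_poly mul1r mulr1.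
by rewrite /path_ends /= !hornerM_comm.
Qed.

Lemma horner1_d p : (D p).[1] = kt_d T p.[1].
Proof.
have h1 n q : (size q <= n)%N -> q.[1] = \sum_(i < n) q`_i.
  by move=> /horner_coef_wide ->; apply: eq_bigr => i _; rewrite expr1n mulr1.
rewrite (h1 (size p) (D p) (size_poly _ _)) (h1 (size p) p (leqnn _)) linear_sum.
by apply: eq_bigr => i _; rewrite coef_map.
Qed.

Lemma prim_d inv p : D (prim inv p) = prim inv (D p).
Proof.
by apply/polyP => -[|i]; rewrite coef_map !coef_prim ?coef_map /= ?linear0 ?linearZ.
Qed.

End PathObject.

(** * Homotopies between two dg morphisms *)

Section Homotopy.
Variables (O : comNzRingType) (I : idealr O) (T T' : koszul_tate I).
Variables (inv : nat -> O) (invK : forall n, n.+1%:R * inv n = 1).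
Variables (psi phi : dg_morphism T T').
Local Notation E := (kt_gen T).
Local Notation A := (symalg (kt_gen T')).
Local Notation D := (map_poly (kt_d T')).

Definition end_values s : (A * A)%type := (psi s, phi s).
Lemma end_values_is_linear : linear end_values.
Proof. by move=> a x y; rewrite /end_values !linearP. Qed.
HB.instance Definition _ :=
  GRing.isLinear.Build O (symalg E) (A * A)%type _ end_values end_values_is_linear.

Lemma path_ends_monom (Phi : {lrmorphism symalg E -> path_alg T'}) w :
  (forall i (x : E i), Tagged E x \in w ->
     path_ends (Phi (gen x)) = end_values (gen x)) ->
  path_ends (Phi (monom w)) = end_values (monom w).
Proof.
elim: w => [|[i x] w ih] Phie.
  by rewrite monom_nil /end_values !rmorph1 path_ends1.
rewrite monom_cons rmorphM path_endsM ih ?Phie ?mem_head //.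
  by rewrite /end_values !rmorphM.
by move=> j y yw; apply: Phie; rewrite inE yw orbT.
Qed.

Lemma path_lift : exists Phi : {lrmorphism symalg E -> path_alg T'},
  [/\ forall m s, s \in homog E m -> Phi s \in path_grade m,
      forall i (x : E i), path_ends (Phi (gen x)) = end_values (gen x) &
      forall s, path_d (Phi s) = Phi (kt_d T s)].
Proof.
apply: (@dg_lift O I T (path_dga T') (A * A)%type (@path_ends _ _ T')
  (fun i => end_values \o @gen O E i)) => n Phi PhiG Phie Phid x.
have x1 := gen_homog x; set y := kt_d T (gen x).
have y1 : y \in homog E n by exact: kt_homogS.
have Phiy : path_ends (Phi y) = end_values y.
  move: (y) y1; apply: homog_ind => [|a s t hs ht|w wn].
  - by rewrite !linear0.
  - by rewrite !linearP /= hs ht.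
  by apply: path_ends_monom => i z /tag_wdeg; rewrite wn; exact: Phie.
(* Write a + dt h for [Phi y]. It is closed, and the dt component of this says that a' = [D h]. *)
have := Phid _ _ (leqnn n) y1; rewrite kt_square rmorph0 => -[].
have := PhiG _ _ y1 => /asboolP [].
move: Phiy => []; case: (Phi y) => a h /= a0 a1 ain hin _ /eqP.
rewrite subr_eq0 => /eqP da.
pose Q := (prim inv h).[1].
have Qin : Q \in homog _ n.+1 by apply/horner1_coefs_in/prim_coefs_in.
(* The right-hand side is a cycle of positive degree: the differential of
   [phi (gen x) - psi (gen x)] is a(1) - a(0), and so is that of [Q], the integral of h, because
   [D h] = a'. *)
have [k kin kE] : exists2 k, k \in homog (kt_gen T') n.+2 &
    kt_d T' k = phi (gen x) - psi (gen x) - Q.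
  apply: kt_exact.
    by rewrite !rpredB //; exact: dg_homog.
  rewrite !linearB /= -!dg_comm -/y -horner1_d prim_d -da prim_deriv //.
  by rewrite hornerD hornerN hornerC a0 a1 subrr.
(* The path starts at [psi (gen x)] and has velocity h plus the differential of [k]. With [k]
   constant in t this solves the dt equation, and the choice of [k] makes the path end at
   [phi (gen x)]. *)
exists ((psi (gen x))%:P + (kt_d T' k)%:P * 'X + prim inv h, k%:P).
split.
- apply/asboolP; split=> /= i.
    rewrite !coefD coefMX !coefC; apply: rpredD; last exact: prim_coefs_in.
    have x2 := dg_homog psi x1; have dk := kt_homogS kin.
    by apply: rpredD; case: (i) => [|[|m]] //=; rewrite ?rpred0.
  by rewrite coefC; case: eqP; rewrite ?rpred0.
- congr pair => /=.
    have dX : D ((kt_d T' k)%:P * 'X) = 0.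
      apply/polyP => -[|[|i]]; rewrite coef_map coefMX coefC coef0 /= ?linear0 //.
      exact: kt_square.
    rewrite !raddfD /= prim_d -da prim_deriv // dX map_polyC /= -dg_comm -/y a0.
    by rewrite addr0 addrC subrK.
  rewrite !derivE deriv_prim // mulr1 map_polyC /=.
  by rewrite add0r addrAC subrr add0r.
- congr pair => /=; rewrite !hornerE; first by rewrite prim0 addr0.
  by rewrite -/Q kE -!addrA addNr addr0 addrC subrK.
Qed.

Lemma coefs_in_ge2 m n (p q : {poly A}) :
  coefs_in (homog (kt_gen T') m.+1) p -> coefs_in (homog (kt_gen T') n.+1) q ->
  coefs_in (sym_ge2 (kt_gen T')) (p * q).
Proof.
move=> hp hq i; rewrite coefM; apply: rpred_sum => j _.
by apply: homogM_ge2; [exact: hp|exact: hq].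
Qed.

Definition path_int (u : path_alg T') : A := (prim inv u.2).[1].
Lemma path_int_is_linear : linear path_int.
Proof.
move=> a u v; rewrite /path_int /= raddfD /= hornerD; congr (_ + _).
have -> : prim inv (pcst T' a * u.2) = (a%:A)%:P * prim inv u.2.
  apply/polyP => -[|i]; rewrite coefCM !coef_prim ?mulr0 // mulr_algl.
  by rewrite coef_pcstM !scalerA mulrC.
by rewrite hornerCM mulr_algl.
Qed.
HB.instance Definition _ :=
  GRing.isLinear.Build O (path_alg T') A _ path_int path_int_is_linear.

Lemma path_int1 : path_int 1 = 0.
Proof. by rewrite /path_int (raddf0 (prim inv)) horner0. Qed.

(** [H] integrates the dt component of a path of morphisms from [psi] to [phi]; the homotopy formula
    is the integral of the dt component of [path_d (Phi s) = Phi (kt_d T s)]. *)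
Lemma dg_homotopy : exists H : {linear symalg E -> A},
  [/\ forall n s, s \in homog E n -> H s \in homog (kt_gen T') n.+1,
      forall s, s \in homog E 0 -> H s = 0,
      forall s, s \in sym_ge2 E -> H s \in sym_ge2 (kt_gen T') &
      forall s, phi s - psi s = kt_d T' (H s) + H (kt_d T s)].
Proof.
have [Phi [PhiG Phie Phid]] := path_lift.
exists (path_int \o Phi).
split=> [n s /PhiG/asboolP[_ hs]|s /homog0_cst->|s|s] /=.
- exact/horner1_coefs_in/prim_coefs_in.
- by rewrite linearZ /= rmorph1 linearZ /= path_int1 scaler0.
- move=> /lspanP; elim=> [|a x y [[|z [|z' w]] //= _ ->] _ ih].
    by rewrite !linear0 rpred0.
  rewrite !linearP /= rpredD // rpredZ // monom_cons rmorphM.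
  have /PhiG/asboolP[z1 z2] := gen_homog (tagged z).
  have /PhiG/asboolP[w1 w2] := monom_homog (z' :: w).
  apply/horner1_coefs_in/prim_coefs_in => i /=.
  move: w1 w2; rewrite wdeg_cons addSn => w1 w2.
  (* [H] is not a derivation, but each term in the dt component of a product of two positive-degree
     factors is again a product of two positive-degree factors. *)
  rewrite coefD; apply: rpredD; first exact: coefs_in_ge2 z2 w1 i.
  rewrite (parity_poly z1); apply: coefs_in_ge2 w2 i.
  exact: coefs_in_sign.
- have := Phid s; case ePhi: (Phi s) => [a h] dPhi.
  have Phiend : path_ends (Phi s) = end_values s.
    move: (s); apply: sym_ind => [|b t t' ht ht'|w]; first by rewrite !linear0.
      by rewrite !linearP /= ht ht'.
    exact: path_ends_monom.
  move: Phiend; rewrite ePhi => -[<- <-]; rewrite -dPhi /path_int /=.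
  rewrite raddfB /= prim_deriv // -horner1_d prim_d.
  by rewrite !hornerD !hornerN hornerC [RHS]addrC subrK.
Qed.

End Homotopy.

(** * Chain homotopies and their effect on homology *)

Section ChainHomotopy.
Variable R : pzRingType.
Implicit Types C D F : chain_complex R.

Lemma homotopic_eq C D (f g : chain_map C D) :
  (forall n, f n =1 g n) -> homotopic f g.
Proof.
move=> fg; exists (fun n => \0); split=> [x|n x] /=.
  by rewrite fg subrr linear0.
by rewrite fg subrr linear0 addr0.
Qed.

Lemma homotopic_sym C D (f g : chain_map C D) : homotopic f g -> homotopic g f.
Proof.
case=> h [h0 hS]; exists (fun n => -%R \o h n); split=> [x|n x] /=.
  by rewrite linearN -h0 opprB.
by rewrite linearN -opprD -hS opprB.
Qed.

Lemma homotopic_trans C D (f g k : chain_map C D) :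
  homotopic f g -> homotopic g k -> homotopic f k.
Proof.
case=> h [h0 hS] [h' [h0' hS']]; exists (fun n => h n \+ h' n).
split=> [x|n x] /=; first by rewrite linearD /= -h0 -h0' addrA subrK.
by rewrite linearD /= addrACA -hS -hS' addrA subrK.
Qed.

Lemma homotopic_compl C D F (k : chain_map D F) (f g : chain_map C D) :
  homotopic f g -> homotopic (chain_comp k f) (chain_comp k g).
Proof.
case=> h [h0 hS]; exists (fun n => k n.+1 \o h n); split=> [x|n x] /=.
  by rewrite -linearB h0 cm_comm.
by rewrite -linearB hS linearD cm_comm.
Qed.

Lemma homotopic_compr C D F (k : chain_map F C) (f g : chain_map C D) :
  homotopic f g -> homotopic (chain_comp f k) (chain_comp g k).
Proof.
case=> h [h0 hS]; exists (fun n => h n \o k n); split=> [x|n x] /=.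
  exact: h0.
by rewrite hS cm_comm.
Qed.

Lemma homotopy_equivalence_homotopic C D (f g : chain_map C D) :
  homotopic f g -> homotopy_equivalence f -> homotopy_equivalence g.
Proof.
move=> fg [k [kf fk]]; exists k; split.
  exact: homotopic_trans (homotopic_compl k (homotopic_sym fg)) kf.
exact: homotopic_trans (homotopic_compr k (homotopic_sym fg)) fk.
Qed.

Lemma homology_mapE C D (f : chain_map C D) n z :
  homology_map f n (qclass (@is_boundary _ C n) z)
  = qclass (@is_boundary _ D n) (Defs.cycle_map f z).
Proof. exact: quot_liftE. Qed.

Lemma homology_map_homotopic C D (f g : chain_map C D) n :
  homotopic f g -> homology_map f n =1 homology_map g n.
Proof.
case=> h [h0 hS] q; rewrite -[q]qclass_repr !homology_mapE.
apply/qclassE/asboolP; move: (repr _) => {q} z /=.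
(* In the lowest degree the homotopy formula has a single term; above it, the second term vanishes
   on cycles. *)
case: n z => [|n] z; first by exists (h 0%N (cycle_val z)); exact: h0.
exists (h n.+1 (cycle_val z)); rewrite [LHS]hS.
by have /eqP -> := cycle_valP z; rewrite linear0 addr0.
Qed.

Lemma homology_map_id C n : homology_map (chain_id C) n =1 id.
Proof.
by move=> q; rewrite -[q]qclass_repr homology_mapE; congr qclass; exact/val_inj.
Qed.

Lemma homology_map_comp C D F (g : chain_map D F) (f : chain_map C D) n :
  homology_map (chain_comp g f) n =1 homology_map g n \o homology_map f n.
Proof.
move=> q; rewrite -[q]qclass_repr [RHS]/comp !homology_mapE.
by congr qclass; exact/val_inj.
Qed.
End ChainHomotopy.

(** * Functoriality and homotopy invariance of the reduced complex *)

Section ReducedComplex.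
Variables (O : comNzRingType) (I : idealr O).
Implicit Types T : koszul_tate I.

Definition dg_id T : dg_morphism T T :=
  @DgMorphism O I T T idfun (fun _ _ h => h) (fun _ => erefl).

Lemma dg_comp_homog T T' T'' (g : dg_morphism T' T'') (f : dg_morphism T T') n s :
  s \in homog (kt_gen T) n -> (g \o f) s \in homog (kt_gen T'') n.
Proof. by move=> hs; do 2![apply: dg_homog]. Qed.

Lemma dg_comp_comm T T' T'' (g : dg_morphism T' T'') (f : dg_morphism T T') s :
  (g \o f) (kt_d T s) = kt_d T'' ((g \o f) s).
Proof. by rewrite /= !dg_comm. Qed.

Definition dg_comp T T' T'' (g : dg_morphism T' T'') (f : dg_morphism T T') :
    dg_morphism T T'' :=
  @DgMorphism O I T T'' (g \o f) (dg_comp_homog g f) (dg_comp_comm g f).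

Lemma reduced_mapE T T' (f : dg_morphism T T') n (x : kt_gen T n) :
  reduced_map f n (rclass I _ x) = rclass I _ (lin n (f (gen x))).
Proof. exact: red_mapE. Qed.

Lemma reduced_map_id T n : reduced_map (dg_id T) n =1 id.
Proof.
by move=> q; have [x ->] := rclassK q; rewrite reduced_mapE /= lin_gen.
Qed.

(** By [dg_factor], dropping the decomposable part of [f (gen x)] before applying [g] does not
    affect the linear part of the result. *)
Lemma reduced_map_comp T T' T'' (g : dg_morphism T' T'') (f : dg_morphism T T') n :
  reduced_map (dg_comp g f) n =1 chain_comp (reduced_map g) (reduced_map f) n.
Proof.
move=> q; have [x ->] := rclassK q; rewrite reduced_mapE.
apply: esym (etrans (congr1 (reduced_map g n) (reduced_mapE f x)) _).
by rewrite reduced_mapE dg_factor //; exact/dg_homog/gen_homog.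
Qed.

Variables (inv : nat -> O) (invK : forall n, n.+1%:R * inv n = 1).

(** The linear part of [H] is the chain homotopy. In [HE'], [kt_factor] permits replacing
    [H (gen x)] by its linear part under the differential. *)
Lemma reduced_map_homotopic T T' (phi psi : dg_morphism T T') :
  homotopic (reduced_map phi) (reduced_map psi).
Proof.
have [H [Hh H0 H2 HE]] := dg_homotopy invK psi phi.
have HE' n (x : kt_gen T n) :
    rclass I _ (lin n (phi (gen x))) - rclass I _ (lin n (psi (gen x))) =
    red_d T' n (red_map I H n n.+1 (rclass I _ x))
    + rclass I _ (lin n (H (kt_d T (gen x)))).
  rewrite -!linearB HE !linearD /=; congr (_ + _).
  rewrite -(kt_factor (Hh _ _ (gen_homog x))); symmetry.
  exact: etrans (congr1 (red_d T' n) (red_mapE I H _ x)) (red_mapE I _ _ _).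
exists (fun n => red_map I H n n.+1); split=> [q|n q]; have [x ->] := rclassK q.
  (* For index 0 the differential of [x] has degree 0, where [H] vanishes; this matches the missing
     term of [homotopic]. *)
  rewrite !reduced_mapE HE' H0 ?linear0 ?addr0 //; exact/kt_homogS/gen_homog.
rewrite !reduced_mapE HE'; congr (_ + _).
symmetry; apply: etrans (congr1 (red_map I H n n.+1) (red_mapE I _ _ _)) _.
apply: etrans (red_mapE I _ _ _) (congr1 (rclass I _) _).
(* Since [H] preserves decomposables, only the linear part of the differential of [x]
   contributes. *)
apply: (@lin_factor _ _ _ (lin n.+1 \o H)) => [s /H2|]; first exact: lin_sym_ge2.
exact/kt_homogS/gen_homog.
Qed.

(** Any dg morphism in the other direction gives a homotopy inverse: the composites and the
    identities are all induced by dg morphisms, hence homotopic. *)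
Lemma reduced_map_equivalence T T' (phi : dg_morphism T T') :
  homotopy_equivalence (reduced_map phi).
Proof.
have [psi] := dg_morphism_exists T' T.
have comp_id (S S' : koszul_tate I) (f : dg_morphism S S') (g : dg_morphism S' S) :
    homotopic (chain_comp (reduced_map g) (reduced_map f)) (chain_id _).
  have fg := homotopic_eq (reduced_map_comp g f).
  have gf := reduced_map_homotopic (dg_comp g f) (dg_id S).
  apply: homotopic_trans (homotopic_sym fg) (homotopic_trans gf _).
  by apply: homotopic_eq => n x; exact: reduced_map_id.
by exists (reduced_map psi); split; exact: comp_id.
Qed.
End ReducedComplex.

(** * The distinguished homotopy class and the canonical isomorphisms on homology *)

Theorem corollaryC7 (K : fieldType) (charK : [pchar K] =i pred0)
    (O : comAlgType K) (I : idealr O) :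
  (forall T T' : koszul_tate I,
    [/\ homotopy_equivalent (reduced_complex T) (reduced_complex T'),
        inhabited (dg_morphism T T') &
        exists! H : chain_map (reduced_complex T) (reduced_complex T') -> Prop,
          [/\ homotopy_class H,
              forall f, H f -> homotopy_equivalence f &
              forall phi : dg_morphism T T', H (reduced_map phi)]]) /\
  (exists can : forall (T T' : koszul_tate I) (n : nat),
      {linear homology (reduced_complex T) n ->
              homology (reduced_complex T') n},
    [/\ forall T T' n, bijective (can T T' n),
        forall T T' (phi : dg_morphism T T') n,
          homology_map (reduced_map phi) n =1 can T T' n,
        forall T n, can T T n =1 id &
        forall T T' T'' n, can T' T'' n \o can T T' n =1 can T T'' n]).
Proof.
(* Characteristic 0 enters here: positive integers are inverted in [K] and carried to [O]. *)
pose inv n : O := (n.+1%:R^-1 : K)%:A.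
have invK n : n.+1%:R * inv n = 1.
  have n0 : n.+1%:R != 0 :> K by rewrite ((pcharf0P K).1 charK).
  by rewrite mulr_algr -(scaler_nat n.+1 (1 : O)) scalerA mulVf ?scale1r.
have homot := reduced_map_homotopic invK; have equiv := reduced_map_equivalence invK.
split=> [T T'|].
  have [phi] := dg_morphism_exists T T'; split=> //.
    by exists (reduced_map phi); exact: equiv.
  exists (homotopic (reduced_map phi)); split.
    split=> [|f phif|psi]; last exact: homot.
      by exists (reduced_map phi).
    exact: homotopy_equivalence_homotopic phif (equiv _ _ _ phi).
  (* Uniqueness: any competing class contains [reduced_map phi], so its representative [f] is
     homotopic to it and both classes have the same members. *)
  move=> H [[f fH] _ /(_ phi)/fH fphi]; apply/funext => g; apply/propext.
  rewrite fH; split; first exact: homotopic_trans fphi.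
  exact/homotopic_trans/homotopic_sym.
(* An arbitrary choice of dg morphism, on which the map in homology does not depend by [canE]. *)
pose can_dg (T T' : koszul_tate I) : dg_morphism T T' :=
  inhabited_witness (dg_morphism_exists T T').
exists (fun T T' n => homology_map (reduced_map (can_dg T T')) n).
have canE T T' (phi : dg_morphism T T') n :
    homology_map (reduced_map phi) n =1 homology_map (reduced_map (can_dg T T')) n.
  by apply: homology_map_homotopic; exact: homot.
have can1 T n : homology_map (reduced_map (can_dg T T)) n =1 id.
  move=> q; rewrite -(canE _ _ (dg_id T)) -[RHS](homology_map_id q).
  by apply/homology_map_homotopic/homotopic_eq => m x; exact: reduced_map_id.
have canM T T' T'' n : homology_map (reduced_map (can_dg T' T'')) n \o
    homology_map (reduced_map (can_dg T T')) n
      =1 homology_map (reduced_map (can_dg T T'')) n.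
  move=> q; rewrite -(canE _ _ (dg_comp (can_dg T' T'') (can_dg T T'))).
  rewrite -[LHS]homology_map_comp; apply: homology_map_homotopic.
  by apply: homotopic_eq => m x; rewrite reduced_map_comp.
split=> // T T' n.
by exists (homology_map (reduced_map (can_dg T' T)) n) => q;
  apply: etrans (canM _ _ _ _ _) (can1 _ _ _).
Qed.
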